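(* Let $\hat D\subset\mathbb{C}^n$ be a set, let $D\subset\hat D$ be open, and let $\mathcal{X}$ be a Banach space of complex-valued functions on $\hat D$ that are analytic in $D$, satisfying Q1–Q3 over $\hat D$. Let $\mathcal{Y}$ be a Banach space of analytic functions on an open set $E\subset\mathbb{C}^m$ satisfying P2 and P3 over $E$. Let $T:\mathcal{X}\to\mathcal{Y}$ be a bounded linear operator such that $Tf$ is cyclic in $\mathcal{Y}$ whenever $f$ is cyclic in $\mathcal{X}$. Then there exist analytic functions $a\in\mathcal{Y}$ and $b:E\to\hat D$ such that $Tf(u)=a(u)f(b(u))$ for every $u\in E$ and $f\in\mathcal{X}$. Moreover, $a=T(1)$ is cyclic and $b=\frac{T(z)}{T(1)}$, where $T(z)$ is the $n$-tuple of functions $(T(z_i))_{i=1}^n$.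
   Context: $\mathcal{P}$ denotes the set of complex polynomials in $n$ variables, regarded as functions on $\hat D$. A Banach space $\mathcal{X}$ of complex-valued functions on a set $\hat D\subset\mathbb{C}^n$ satisfies Q1–Q3 over $\hat D$ if: (Q1) $\mathcal{P}$ is a dense subset of $\mathcal{X}$. (Q2) For every $z\in\hat D$ the point evaluation $\Lambda_z:\mathcal{X}\to\mathbb{C}$, $\Lambda_z f:=f(z)$, is a bounded linear functional on $\mathcal{X}$. Furthermore, if for some $z\in\mathbb{C}^n$ the map $p\mapsto p(z)$, $p\in\mathcal{P}$, extends to a bounded linear functional on all of $\mathcal{X}$, then $z\in\hat D$. (Q3) For every $1\le i\le n$ the shift operator $S_i:\mathcal{X}\to\mathcal{X}$, $(S_if)(z):=z_if(z)$, is a (well-defined) bounded linear operator. A Banach space $\mathcal{Y}$ of analytic functions on an open set $E\subset\mathbb{C}^m$ satisfies P2 if $g\mapsto g(u)$ is a bounded linear functional on $\mathcal{Y}$ for every $u\in E$, and P3 if $g\mapsto u_ig$ (multiplication by the $i$-th coordinate function) is a bounded linear operator $\mathcal{Y}\to\mathcal{Y}$ for every $1\le i\le m$. In either space, a function $f$ is cyclic if the closed linear span of $\{z^\alpha f:\alpha\in\mathbb{Z}_{\ge0}^k\}$ ($k$ being the number of variables) is the whole space. $z_i$ denotes the $i$-th coordinate function. *)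

(* Defs.v *)
From HB Require Import structures.
From mathcomp Require Import all_boot all_order all_algebra finmap.
From mathcomp Require Import complex.
From mathcomp Require Import all_classical all_reals all_analysis.
From mathcomp Require Import summability.
(* Without notations: those of mpoly clash with those of analysis. *)
From mathcomp Require Import (canonicals, coercions) mpoly.

Set Implicit Arguments.
Unset Strict Implicit.
Unset Printing Implicit Defensive.
Import Order.TTheory GRing.Theory Num.Theory.
Import numFieldNormedType.Exports.
Local Open Scope classical_set_scope.
Local Open Scope ring_scope.

(* The ascription makes the norm topology available on the complex numbers.
   The definitions below are written over an arbitrary C, only to keep the
   representation of complex numbers out of them; C is meant to be Cx R. *)
Definition Cx (R : realType) : numClosedFieldType := R[i].
Arguments Cx : simpl never.

Definition monomial (C : numClosedFieldType) (k : nat) (z : 'rV[C]_k)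
    (alpha : mpoly.multinom k) : C :=
  \prod_(i < k) z 0 i ^+ alpha i.

(* Multi-index power series are summed along the filter of finite sets of
   multi-indices, i.e. unconditionally (equivalently, absolutely). *)
Definition analytic_on (C : numClosedFieldType) (k : nat) (U : set 'rV[C]_k)
    (f : 'rV[C]_k -> C) : Prop :=
  forall z, U z -> exists c : mpoly.multinom k -> C,
    \forall w \near z,
      (fun A : {fset mpoly.multinom k} =>
         \sum_(alpha <- A) c alpha * monomial (w - z) alpha : C) @ totally
        --> f w.

(* A norm over C takes its values in the nonnegative elements of C. *)
Definition bounded_map (C : numClosedFieldType) (V W : normedModType C)
    (L : V -> W) : Prop :=
  exists M : C, forall x, `|L x| <= M * `|x|.

(* A Banach space of functions on S: a Banach space whose vectors are
   determined by their values on S, with pointwise operations. The values of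
   fval f outside S carry no information. *)
Record banach_fun_space (C : numClosedFieldType) (k : nat)
    (S : set 'rV[C]_k) := {
  carrier :> completeNormedModType C;
  fval : carrier -> 'rV[C]_k -> C;
  fval_linear : forall (c : C) (f g : carrier) z, S z ->
    fval (c *: f + g) z = c * fval f z + fval g z;
  fval_inj : forall f g : carrier,
    (forall z, S z -> fval f z = fval g z) -> f = g }.

Section FunctionSpaces.
Variables (C : numClosedFieldType) (k : nat) (S : set 'rV[C]_k).
Variable X : banach_fun_space S.

(* The element f of X is the restriction of F to S. *)
Definition represents (f : X) (F : 'rV[C]_k -> C) : Prop :=
  forall z, S z -> fval f z = F z.

Definition peval (p : mpoly.mpoly k C) (z : 'rV[C]_k) : C :=
  mpoly.meval (fun i => z 0 i) p.

Definition polynomials_dense : Prop :=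
  (forall p, exists f : X, represents f (peval p)) /\
  dense [set f : X | exists p, represents f (peval p)].

Definition evaluations_bounded : Prop :=
  forall z, S z -> bounded_map (fun f : X => fval f z : C^o).

Definition domain_maximal : Prop :=
  forall (z : 'rV[C]_k) (L : {linear X -> C^o}),
    bounded_map L ->
    (forall p (f : X), represents f (peval p) -> L f = peval p z) ->
    S z.

Definition shifts_bounded : Prop :=
  forall i : 'I_k, exists Si : {linear X -> X},
    bounded_map Si /\
    forall f : X, represents (Si f) (fun z => z 0 i * fval f z).

Definition linear_span (A : set X) : set X :=
  [set g | exists (N : nat) (c : 'I_N -> C) (h : 'I_N -> X),
     (forall j, A (h j)) /\ g = \sum_(j < N) c j *: h j].

Definition monomial_multiples (f : X) : set X :=
  [set h | exists alpha,
     represents h (fun z => monomial z alpha * fval f z)].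

Definition cyclic_vector (f : X) : Prop :=
  closure (linear_span (monomial_multiples f)) = [set: X].

Definition Q1 := polynomials_dense.
Definition Q2 := evaluations_bounded /\ domain_maximal.
Definition Q3 := shifts_bounded.
Definition P2 := evaluations_bounded.
Definition P3 := shifts_bounded.

End FunctionSpaces.

(* Main.v *)
Require Import Defs.
From HB Require Import structures.
From mathcomp Require Import all_boot all_order all_algebra finmap.
From mathcomp Require Import complex.
From mathcomp Require Import all_classical all_reals all_analysis.
From mathcomp Require Import summability ring lra.
From mathcomp Require Import (canonicals, coercions) mpoly.
From mathcomp Require cyclic separable cyclotomic.

Set Implicit Arguments.
Unset Strict Implicit.
Unset Printing Implicit Defensive.
Import Order.TTheory GRing.Theory Num.Theory.
Import numFieldNormedType.Exports.
Local Open Scope classical_set_scope.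
Local Open Scope ring_scope.

(** Write a = T 1.  It is cyclic because 1 is, so the vectors q a, with q a
    polynomial, are dense in Y, and everything happens through the map
    q a |-> q(u) at a point u of E.

    Suppose that a does not vanish identically near u0.  Its leading homogeneous
    form at u0 provides a complex direction v and a radius rho such that |a| is
    bounded below on the circles u + t v, |t| = rho, for all u near u0
    ([circle_lower_bound]).  Evaluations on Y are bounded uniformly near u0
    ([evaluations_locally_bounded]), so the maximum principle for q on these
    circles gives |q(u)| <= M |q a| for all polynomials q and all u near u0
    ([dominated_near]).  Hence q a |-> q(u) extends to a bounded functional N_u
    on Y with N_u(a) = 1, N_u(q g) = q(u) N_u(g) and g(u) = a(u) N_u(g).  This
    makes sense even when a(u) = 0, where the quotient g / a has no direct
    meaning.

    The functional N_u o T on X takes the value 1 at 1 and vanishes at no cyclic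
    vector f: since T f is cyclic, a is a limit of vectors q (T f), so
    N_u(T f) = 0 would force N_u(a) = 0.  By a theorem of Gleason, Kahane and
    Zelazko ([gleason_kahane_zelazko]) such a functional is the evaluation at a
    point b(u) of the domain of X, and T f (u) = a(u) N_u(T f) = a(u) f(b(u)).
    The proof follows Roitman and Sternfeld and needs only the fundamental
    theorem of algebra.  The i-th coordinate of b is N_u(T z_i), which is a
    locally uniform limit of polynomials in u because of the bound M; such a
    limit has a power series expansion by Cauchy's estimates
    ([approx_expansion]).

    Where a vanishes identically near a point, every element of Y vanishes
    there, T f = 0, and b may be any constant in the domain of X.  The two
    regimes do not meet inside E, by the identity theorem
    ([identity_principle]), so b is analytic on the whole of E.

    No contour integral is needed: Cauchy's estimates and the maximum principle
    are only applied to polynomials, where integrals over circles can be replaced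
    by averages over roots of unity ([cauchy_estimate]). *)

(** * A real-valued norm on complex normed modules *)

Definition toC (R : realType) (x : R) : Cx R := complex.real_complex R x.

(** The norm of a module over C takes its values in C, whose order is only
    partial; reading it in R makes estimates comparable. *)
Definition nm (R : realType) (V : normedModType (Cx R)) (x : V) : R :=
  complex.Re `|x|.

Section ToC.
Variable R : realType.
Implicit Types x y : R.

Lemma toC_le x y : (toC x <= toC y) = (x <= y).
Proof. exact: complex.lecR. Qed.

Lemma toC_lt x y : (toC x < toC y) = (x < y).
Proof. exact: complex.ltcR. Qed.

Lemma toCD x y : toC (x + y) = toC x + toC y.
Proof. exact: raddfD. Qed.

Lemma toCM x y : toC (x * y) = toC x * toC y.
Proof. exact: rmorphM. Qed.

Lemma toC0 : toC (0 : R) = 0.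
Proof. by []. Qed.

Lemma toCn n : toC (n%:R : R) = n%:R.
Proof. exact: rmorph_nat. Qed.

Lemma toCV x : toC (x^-1) = (toC x)^-1.
Proof. exact: fmorphV. Qed.

Lemma toC_Re (z : Cx R) : 0 <= z -> toC (complex.Re z) = z.
Proof. by move=> z0; apply: complex.RRe_real; exact: ger0_real. Qed.
End ToC.

Section Norm.
Variable R : realType.
Variable V : normedModType (Cx R).
Implicit Types x y : V.

Lemma nmE x : toC (nm x) = `|x|.
Proof. exact: toC_Re. Qed.

Lemma nm_ge0 x : 0 <= nm x.
Proof. by rewrite -toC_le nmE toC0. Qed.

Lemma nm0 : nm (0 : V) = 0.
Proof. by rewrite /nm normr0. Qed.

Lemma nm_le0 x : nm x <= 0 -> x = 0.
Proof. by rewrite -toC_le nmE toC0 normr_le0 => /eqP. Qed.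

Lemma nmD x y : nm (x + y) <= nm x + nm y.
Proof. by rewrite -toC_le toCD !nmE ler_normD. Qed.

Lemma nmN x : nm (- x) = nm x.
Proof. by rewrite /nm normrN. Qed.

Lemma nmB x y : nm (x - y) <= nm x + nm y.
Proof. by rewrite -[nm y]nmN nmD. Qed.

Lemma nmC x y : nm (x - y) = nm (y - x).
Proof. by rewrite -nmN opprB. Qed.

Lemma nm_trans z x y : nm (x - y) <= nm (x - z) + nm (z - y).
Proof. by rewrite (le_trans _ (nmD _ _)) // addrA subrK. Qed.

Lemma nm_le_dist x y : nm y <= nm (y - x) + nm x.
Proof. by have := nm_trans x y 0; rewrite !subr0. Qed.

Lemma nm_sum (I : Type) (r : seq I) (P : pred I) (F : I -> V) :
  nm (\sum_(i <- r | P i) F i) <= \sum_(i <- r | P i) nm (F i).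
Proof.
elim/big_rec2: _ => [|i y x _ h]; first by rewrite nm0.
by rewrite (le_trans (nmD _ _)) // lerD2l.
Qed.

Lemma nm_eq x y : (forall e : R, 0 < e -> nm (x - y) <= e) -> x = y.
Proof.
move=> h; apply/eqP; rewrite -subr_eq0; apply/eqP/nm_le0.
by apply/ler_addgt0Pr => e e0; rewrite add0r h.
Qed.

End Norm.

Section NormC.
Variable R : realType.
Notation C := (Cx R).

Lemma nmZ (V : normedModType C) (c : C) (x : V) :
  nm (c *: x) = nm (c : C^o) * nm x.
Proof.
by apply: complex.complexI; rewrite -!/(toC _) toCM !nmE normrZ.
Qed.

Lemma nmM (c d : C) : nm (c * d : C^o) = nm (c : C^o) * nm (d : C^o).
Proof. exact: (nmZ c (d : C^o)). Qed.

Lemma nm1 : nm (1 : C^o) = 1.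
Proof. by rewrite /nm normr1. Qed.

Lemma nmX (c : C) n : nm (c ^+ n : C^o) = nm (c : C^o) ^+ n.
Proof.
elim: n => [|n IH]; first by rewrite !expr0 nm1.
by rewrite !exprS nmM IH.
Qed.

Lemma nm_prod (I : Type) (r : seq I) (P : pred I) (F : I -> C) :
  nm (\prod_(i <- r | P i) F i : C^o) = \prod_(i <- r | P i) nm (F i : C^o).
Proof.
elim/big_rec2: _ => [|i y x _ h]; first by rewrite nm1.
by rewrite nmM h.
Qed.

Lemma nm_toC (x : R) : nm (toC x : C^o) = `|x|.
Proof.
by rewrite /nm complex.normc_def /= expr0n addr0 sqrtr_sqr.
Qed.

Lemma nm_nat n : nm (n%:R : C^o) = n%:R.
Proof. by rewrite -toCn nm_toC ger0_norm. Qed.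

Lemma nmV (c : C) : nm (c^-1 : C^o) = (nm (c : C^o))^-1.
Proof.
by apply: complex.complexI; rewrite -!/(toC _) toCV !nmE normfV.
Qed.

Lemma nm_neq0 (c : C) : c != 0 -> 0 < nm (c : C^o).
Proof.
move=> c0; rewrite lt_neqAle nm_ge0 andbT eq_sym; apply: contraNneq c0 => h.
by apply/eqP; apply: (@nm_le0 R C^o); rewrite h.
Qed.

Lemma boundedP (V W : normedModType C) (L : V -> W) :
  bounded_map L <-> exists M : R, 0 <= M /\ forall x, nm (L x) <= M * nm x.
Proof.
split=> [[M hM]|[M [M0 hM]]].
  exists (nm (M : C^o)); split=> [|x]; first exact: nm_ge0.
  rewrite -toC_le toCM !nmE.
  have MX : 0 <= M * `|x| by exact: le_trans (hM x).
  by rewrite (le_trans (hM x)) // -(ger0_norm MX) normrM normr_id.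
by exists (toC M) => x; rewrite -!nmE -toCM toC_le.
Qed.

Lemma ballP (V : normedModType C) (x : V) (P : set V) :
  nbhs x P <-> exists r : R, 0 < r /\ forall y, nm (y - x) < r -> P y.
Proof.
split=> [/nbhs_normP[e /= e0 he]|[r [r0 h]]].
  exists (complex.Re e); rewrite -toC_lt toC_Re ?ltW //; split=> // y.
  rewrite -toC_lt nmE toC_Re ?ltW // => hy; apply: he => /=.
  by rewrite distrC.
apply/nbhs_normP; exists (toC r); first by rewrite /= -toC0 toC_lt.
by move=> y /=; rewrite distrC -nmE toC_lt => /h.
Qed.

Lemma near_rowP k (z : 'rV[C]_k) (P : set 'rV[C]_k) :
  nbhs z P <-> exists r : R, 0 < r /\
    forall y : 'rV[C]_k, (forall i, nm (y 0 i - z 0 i : C^o) < r) -> P y.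
Proof.
split=> [/nbhs_ballP[e /= e0 he]|[r [r0 h]]].
  exists (complex.Re e); rewrite -toC_lt toC_Re ?ltW //; split=> // y hy.
  apply: he; split=> // i j; rewrite !ord1; have := hy j.
  rewrite -toC_lt nmE toC_Re ?ltW // => hyj.
  by rewrite -ball_normE /= distrC.
apply/nbhs_ballP; exists (toC r); first by rewrite /= -toC0 toC_lt.
move=> y [_ hy]; apply: h => i; have := hy 0 i.
by rewrite -ball_normE /= distrC -(@nmE R C^o) toC_lt.
Qed.

Lemma totally_cvgP (I : choiceType) (F : {fset I} -> C) (l : C) :
  (F @ totally --> l) <-> forall e : R, 0 < e -> exists A0 : {fset I},
     forall A, (A0 `<=` A)%fset -> nm (F A - l : C^o) < e.
Proof.
split=> [cv e e0|h].
  have /cv [A0 _ hA0] : nbhs (l : C^o) [set y | nm (y - l : C^o) < e].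
    by apply/ballP; exists e.
  by exists A0 => A AA; apply: hA0.
move=> P /(@ballP C^o)[r [r0 hr]]; have [A0 hA] := h _ r0.
by exists A0 => // A /= AA; apply: hr; apply: hA.
Qed.

Definition cauchyR (V : normedModType C) (x : nat -> V) :=
  forall e : R, 0 < e -> exists N, forall m n, (N <= m)%N -> (N <= n)%N ->
    nm (x m - x n) < e.

Definition cvgR (V : normedModType C) (x : nat -> V) (l : V) :=
  forall e : R, 0 < e -> exists N, forall n, (N <= n)%N -> nm (x n - l) < e.

Lemma banach_complete (V : completeNormedModType C) (x : nat -> V) :
  cauchyR x -> exists l, cvgR x l.
Proof.
move=> cx; have /cauchy_cvg : cauchy (x @ \oo).
  apply: cauchy_exP => e e0.
  have e0' : (0 < complex.Re e)%R by rewrite -toC_lt toC_Re ?ltW.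
  have [N hN] := cx _ e0'; exists (x N), N => // n /= Nn.
  by rewrite -ball_normE /= -nmE -[e]toC_Re ?ltW // toC_lt; apply: hN.
move=> /cvg_ex[l cvl]; exists l => e e0.
have /cvl [N _ hN] : nbhs l [set y | nm (y - l) < e] by apply/ballP; exists e.
by exists N => n Nn; apply: hN.
Qed.

Lemma nm_i : nm ('i%C : C^o) = 1.
Proof.
rewrite /nm complex.normc_def /=.
by rewrite expr0n /= expr1n add0r sqrtr1.
Qed.

Lemma Re_le (z : C) : `|complex.Re z| <= nm (z : C^o).
Proof. by rewrite -toC_le nmE; exact: complex.normc_ge_Re. Qed.

Lemma Im_le (z : C) : `|complex.Im z| <= nm (z : C^o).
Proof.
have -> : complex.Im z = - complex.Re (z * 'i%C) by rewrite complex.ReiNIm opprK.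
by rewrite normrN (le_trans (Re_le _)) // nmM nm_i mulr1.
Qed.

Lemma nm_ReIm (z : C) :
  nm (z : C^o) <= `|complex.Re z| + `|complex.Im z|.
Proof.
have zE : z = toC (complex.Re z) + 'i%C * toC (complex.Im z).
  exact: complex.complexE.
by rewrite {1}zE (le_trans (nmD _ _)) // nmM !nm_toC nm_i mul1r.
Qed.

Lemma R_complete (x : nat -> R) :
  (forall e : R, 0 < e -> exists N, forall m n, (N <= m)%N -> (N <= n)%N ->
    `|x m - x n| < e) ->
  exists l, forall e : R, 0 < e -> exists N, forall n, (N <= n)%N ->
    `|x n - l| < e.
Proof.
move=> cx; have /cauchy_cvg : cauchy (x @ \oo).
  apply: cauchy_exP => e e0.
  have [N hN] := cx _ e0; exists (x N), N => // n /= Nn.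
  by rewrite -ball_normE /=; apply: hN.
move=> /cvg_ex[l cvl]; exists l => e e0.
have /cvl [N _ hN] : nbhs l [set y | `|y - l| < e].
  by apply/nbhs_normP; exists e => //= y /=; rewrite distrC.
by exists N => n Nn; apply: hN.
Qed.

(** R[i] is complete because its real and imaginary parts are real Cauchy
    sequences. *)
Lemma C_complete (x : nat -> C^o) : cauchyR x -> exists l, cvgR x l.
Proof.
move=> cx.
have [a ha] : exists l, forall e : R, 0 < e -> exists N, forall n, (N <= n)%N ->
    `|complex.Re (x n) - l| < e.
  apply: R_complete => e e0; have [N hN] := cx e e0; exists N => m n Nm Nn.
  by rewrite -raddfB (le_lt_trans (Re_le _)) // hN.
have [b hb] : exists l, forall e : R, 0 < e -> exists N, forall n, (N <= n)%N ->
    `|complex.Im (x n) - l| < e.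
  apply: R_complete => e e0; have [N hN] := cx e e0; exists N => m n Nm Nn.
  by rewrite -raddfB (le_lt_trans (Im_le _)) // hN.
exists (complex.Complex a b : C) => e e0.
have e2 : 0 < e / 2 by lra.
have [N1 h1] := ha _ e2; have [N2 h2] := hb _ e2.
exists (maxn N1 N2) => n; rewrite geq_max => /andP[n1 n2].
rewrite (le_lt_trans (nm_ReIm _)) //.
have := h1 _ n1; have := h2 _ n2.
rewrite (raddfB (@complex.Re R)) (raddfB (@complex.Im R)) /=; lra.
Qed.

Lemma closure_fullP (V : normedModType C) (A : set V) :
  closure A = [set: V] <->
  forall x (e : R), 0 < e -> exists y, A y /\ nm (x - y) < e.
Proof.
split=> [cA x e e0|h].
  have : closure A x by rewrite cA.
  move=> /(_ [set y | nm (y - x) < e]) [|y [Ay /= hy]].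
    by apply/ballP; exists e.
  by exists y; rewrite nmC.
apply/seteqP; split=> // x _ P /ballP[r [r0 hr]].
have [y [Ay hy]] := h x r r0; exists y; split=> //; apply: hr.
by rewrite nmC.
Qed.

Lemma denseP (V : normedModType C) (A : set V) : dense A ->
  forall x (e : R), 0 < e -> exists y, A y /\ nm (x - y) < e.
Proof.
move=> dA x e e0.
have [||y [/= hy Ay]] := dA [set y | nm (y - x) < e].
- by exists x; rewrite /= subrr nm0.
- rewrite openE => y /= hy; apply/ballP; exists (e - nm (y - x)).
  split=> [|z hz]; first by rewrite subr_gt0.
  by have := nm_trans y z x; rewrite /=; lra.
by exists y; rewrite nmC.
Qed.

End NormC.

Lemma half_pow (R : realType) (K e : R) : 0 < e ->
  exists n, forall m, (n <= m)%N -> 2^-1 ^+ m * K < e.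
Proof.
move=> e0; exists (Num.truncn (K / e)).+1 => m nm.
rewrite exprVn mulrC ltr_pdivrMr ?exprn_gt0 // mulrC -ltr_pdivrMr //.
rewrite (lt_le_trans (truncnS_gt _)) // -natrX ler_nat.
by rewrite (leq_trans nm) // ltnW // ltn_expl.
Qed.

(** * Multiplication by polynomials and cyclic vectors *)

Section Peval.
Variables (R : realType) (k : nat).
Notation C := (Cx R).
Implicit Types (p q : mpoly.mpoly k C) (z : 'rV[C]_k).

Lemma peval0 z : peval (0 : mpoly.mpoly k C) z = 0.
Proof. exact: mpoly.meval0. Qed.

Lemma peval1 z : peval (1 : mpoly.mpoly k C) z = 1.
Proof. exact: mpoly.meval1. Qed.

Lemma pevalD p q z : peval (p + q) z = peval p z + peval q z.
Proof. exact: mpoly.mevalD. Qed.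

Lemma pevalB p q z : peval (p - q) z = peval p z - peval q z.
Proof. exact: mpoly.mevalB. Qed.

Lemma pevalM p q z : peval (p * q) z = peval p z * peval q z.
Proof. exact: mpoly.mevalM. Qed.

Lemma pevalZ c p z : peval (c *: p) z = c * peval p z.
Proof. exact: mpoly.mevalZ. Qed.

Lemma pevalX m z : peval (mpoly.mpolyX C m) z = monomial z m.
Proof. exact: mpoly.mevalX. Qed.

Lemma peval_sum (I : Type) (r : seq I) (P : pred I)
    (F : I -> mpoly.mpoly k C) z :
  peval (\sum_(i <- r | P i) F i) z = \sum_(i <- r | P i) peval (F i) z.
Proof. by elim/big_rec2: _ => [|i y x _ <-]; rewrite ?peval0 ?pevalD. Qed.

Lemma pevalU i z : peval (mpoly.mpolyX C (mpoly.mnm1 i)) z = z 0 i.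
Proof. exact: mpoly.mevalXU. Qed.

End Peval.

Section FunSpace.
Variables (R : realType) (k : nat).
Notation C := (Cx R).
Variables (S : set 'rV[C]_k) (X : banach_fun_space S).
Implicit Types (f g h : X) (p q : mpoly.mpoly k C).

Lemma fvalD f g z : S z -> fval (f + g) z = fval f z + fval g z.
Proof. by move=> Sz; rewrite -[f in LHS]scale1r fval_linear // mul1r. Qed.

Lemma fval0 z : S z -> fval (0 : X) z = 0.
Proof.
by move=> Sz; apply: (addrI (fval (0 : X) z)); rewrite -fvalD // !addr0.
Qed.

Lemma fvalZ c f z : S z -> fval (c *: f) z = c * fval f z.
Proof. by move=> Sz; rewrite -[_ *: _]addr0 fval_linear // fval0 // addr0. Qed.

Lemma fvalB f g z : S z -> fval (f - g) z = fval f z - fval g z.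
Proof. by move=> Sz; rewrite -scaleN1r fvalD // fvalZ // mulN1r. Qed.

Lemma fval_sum (I : Type) (r : seq I) (P : pred I) (F : I -> X) z : S z ->
  fval (\sum_(i <- r | P i) F i) z = \sum_(i <- r | P i) fval (F i) z.
Proof.
by move=> Sz; elim/big_rec2: _ => [|i y x _ <-]; rewrite ?fval0 ?fvalD.
Qed.

Definition bounded_multiplier p := exists M : R, 0 <= M /\ forall g, exists h,
  represents h (fun z => peval p z * fval g z) /\ nm h <= M * nm g.

Lemma bounded_multiplierD p q : bounded_multiplier p ->
  bounded_multiplier q -> bounded_multiplier (p + q).
Proof.
move=> [M [M0 hM]] [N [N0 hN]]; exists (M + N); split; first exact: addr_ge0.
move=> g; have [h [hr hb]] := hM g; have [h' [hr' hb']] := hN g.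
exists (h + h'); split.
  by move=> z Sz; rewrite fvalD // hr // hr' // pevalD mulrDl.
by rewrite (le_trans (nmD _ _)) // mulrDl lerD.
Qed.

Lemma bounded_multiplierM p q : bounded_multiplier p ->
  bounded_multiplier q -> bounded_multiplier (p * q).
Proof.
move=> [M [M0 hM]] [N [N0 hN]]; exists (M * N); split; first exact: mulr_ge0.
move=> g; have [h [hr hb]] := hN g; have [h' [hr' hb']] := hM h.
exists h'; split; first by move=> z Sz; rewrite hr' // hr // pevalM mulrA.
by rewrite (le_trans hb') // -mulrA ler_wpM2l.
Qed.

Lemma bounded_multiplierZ c p : bounded_multiplier p ->
  bounded_multiplier (c *: p).
Proof.
move=> [M [M0 hM]]; exists (nm (c : C^o) * M).
split; first by rewrite mulr_ge0 // nm_ge0.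
move=> g; have [h [hr hb]] := hM g; exists (c *: h); split.
  by move=> z Sz; rewrite fvalZ // hr // pevalZ mulrA.
by rewrite nmZ -mulrA ler_wpM2l // nm_ge0.
Qed.

Lemma bounded_multiplier1 : bounded_multiplier 1.
Proof.
exists 1; split=> // g; exists g; split; last by rewrite mul1r.
by move=> z Sz; rewrite peval1 mul1r.
Qed.

Hypothesis shifts : shifts_bounded X.

(** Bounded multipliers form an algebra, and the coordinates belong to it by the
    boundedness of the shifts. *)
Lemma all_bounded_multiplier p : bounded_multiplier p.
Proof.
elim/mpoly.mpolyind: p => [|c m p _ _ IH].
  rewrite -(scale0r (1 : mpoly.mpoly k C)).
  exact/bounded_multiplierZ/bounded_multiplier1.
apply: (bounded_multiplierD _ IH); apply: bounded_multiplierZ.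
rewrite mpoly.mpolyXE_id; elim/big_ind: _ => [||i _].
- exact: bounded_multiplier1.
- exact: bounded_multiplierM.
elim: (m i) => [|n IHn].
  rewrite expr0; exact: bounded_multiplier1.
rewrite exprS; apply: (bounded_multiplierM _ IHn).
have [Si [/boundedP[M [M0 hM]] rS]] := shifts i.
exists M; split=> // g; exists (Si g); split=> // z Sz.
by rewrite rS // pevalU.
Qed.

Lemma pmul_ex p g : exists h : X,
  represents h (fun z => peval p z * fval g z).
Proof.
by have [M [_ /(_ g)[h [hr _]]]] := all_bounded_multiplier p; exists h.
Qed.

(** Elements are determined by their values, so any vector representing p g will
    do, and all algebraic identities for this product can be checked
    pointwise. *)
Definition pmul p g : X := sval (cid (pmul_ex p g)).

Lemma pmulE p g z : S z -> fval (pmul p g) z = peval p z * fval g z.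
Proof. by move=> Sz; rewrite /pmul; case: cid => h /= ->. Qed.

Lemma pmul_bounded p : exists M : R, 0 <= M /\
  forall g, nm (pmul p g) <= M * nm g.
Proof.
have [M [M0 hM]] := all_bounded_multiplier p; exists M; split=> // g.
have [h [hr hb]] := hM g; suff -> : pmul p g = h by [].
by apply: fval_inj => z Sz; rewrite pmulE // hr.
Qed.

Lemma pmulDl p q g : pmul (p + q) g = pmul p g + pmul q g.
Proof. by apply: fval_inj => z Sz; rewrite fvalD // !pmulE // pevalD mulrDl. Qed.

Lemma pmulBl p q g : pmul (p - q) g = pmul p g - pmul q g.
Proof. by apply: fval_inj => z Sz; rewrite fvalB // !pmulE // pevalB mulrBl. Qed.

Lemma pmulZl c p g : pmul (c *: p) g = c *: pmul p g.
Proof. by apply: fval_inj => z Sz; rewrite fvalZ // !pmulE // pevalZ mulrA. Qed.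

Lemma pmulA p q g : pmul p (pmul q g) = pmul (p * q) g.
Proof. by apply: fval_inj => z Sz; rewrite !pmulE // pevalM mulrA. Qed.

Lemma pmul1 g : pmul 1 g = g.
Proof. by apply: fval_inj => z Sz; rewrite !pmulE // peval1 mul1r. Qed.

Lemma pmulBr p f g : pmul p (f - g) = pmul p f - pmul p g.
Proof. by apply: fval_inj => z Sz; rewrite fvalB // !pmulE // fvalB // mulrBr. Qed.

Lemma linear_span_monomialP f g :
  linear_span (monomial_multiples f) g <-> exists p, g = pmul p f.
Proof.
split=> [[N [c [h [hm ->]]]]|[p ->]].
  have [al hal] := choice hm.
  exists (\sum_(j < N) c j *: mpoly.mpolyX C (al j)).
  apply: fval_inj => z Sz; rewrite fval_sum // pmulE // peval_sum mulr_suml.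
  apply: eq_bigr => j _.
  by rewrite fvalZ // hal // pevalZ pevalX mulrA.
exists (size (mpoly.msupp p)).
pose al (j : 'I_(size (mpoly.msupp p))) := tnth (in_tuple (mpoly.msupp p)) j.
exists (fun j => mpoly.mcoeff (al j) p).
exists (fun j => pmul (mpoly.mpolyX C (al j)) f); split.
  by move=> j; exists (al j) => z Sz; rewrite pmulE // pevalX.
apply: fval_inj => z Sz; rewrite fval_sum // pmulE // {1}[p]mpoly.mpolyE.
rewrite peval_sum mulr_suml (big_tnth _ _ (mpoly.msupp p)).
by apply: eq_bigr => j _; rewrite pevalZ fvalZ // pmulE // mulrA.
Qed.

Lemma cyclicP f : cyclic_vector f <->
  forall x (e : R), 0 < e -> exists p, nm (x - pmul p f) < e.
Proof.
rewrite /cyclic_vector closure_fullP; split=> h x e e0.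
  have [y [/linear_span_monomialP[p ->] hy]] := h x e e0; by exists p.
have [p hp] := h x e e0; exists (pmul p f); split=> //.
by apply/linear_span_monomialP; exists p.
Qed.

(** When multiplication by q has norm at most 1/2, the multiplier 1 - q is
    invertible in the closure of the polynomials.  The partial sums s_N of the
    geometric series satisfy s_N (1 - q) f = f - q^N f, which tends to f, so
    nothing is lost in passing from f to (1 - q) f. *)
Lemma cyclic_perturb f q (M : R) : 0 <= M -> M <= 2^-1 ->
  (forall g, nm (pmul q g) <= M * nm g) ->
  cyclic_vector f -> cyclic_vector (pmul (1 - q) f).
Proof.
move=> M0 M2 hM /cyclicP cf; apply/cyclicP => x e e0.
have e2 : 0 < e / 2 by lra.
have [p hp] := cf x _ e2.
have hN n : nm (pmul (q ^+ n) (pmul p f)) <= 2^-1 ^+ n * nm (pmul p f).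
  elim: n => [|n IH]; first by rewrite !expr0 pmul1 mul1r.
  rewrite !exprS -pmulA (le_trans (hM _)) // -mulrA ler_pM // nm_ge0 //.
have [n /(_ n (leqnn n)) hn] := half_pow (nm (pmul p f)) e2.
exists (p * \sum_(i < n) q ^+ i).
have -> : pmul (p * \sum_(i < n) q ^+ i) (pmul (1 - q) f) =
    pmul p f - pmul (q ^+ n) (pmul p f).
  rewrite !pmulA -pmulBl -mulrA; congr (pmul _ f).
  rewrite -[1 - q]opprB mulrN [_ * (q - 1)]mulrC -subrX1 opprB.
  by rewrite mulrBr mulr1 [p * _]mulrC.
rewrite opprD opprK addrA (le_lt_trans (nmD _ _)) //.
by rewrite [e]splitr ltrD // (le_lt_trans (hN n)).
Qed.

End FunSpace.

(** * The theorem of Gleason, Kahane and Zelazko *)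

Section Vieta.
Variable F : fieldType.

(** The first coefficients of a product of 1 - r X are elementary symmetric
    functions, hence given by the first two power sums (Vieta, Newton). *)
Lemma coef012_prod (rs : seq F) :
  let P : {poly F} := \prod_(r <- rs) (1 - r *: 'X) in
  [/\ P`_0 = 1, P`_1 = - (\sum_(r <- rs) r) &
      P`_2 *+ 2 = (\sum_(r <- rs) r) ^+ 2 - \sum_(r <- rs) r ^+ 2].
Proof.
rewrite /=; elim: rs => [|r rs [c0 c1 c2]].
  by rewrite !big_nil !coef1 /=; split; ring.
rewrite !big_cons !mulrBl !mul1r -!scalerAl !coefB !coefZ !coefXM /= c0 c1.
by rewrite mulrnBl c2; split; ring.
Qed.

End Vieta.

Lemma square_sum_identity (F : comNzRingType) (k A B b s : F) :
  b *+ 2 = k * (k - 1) -> b * B *+ 2 = (k * A) ^+ 2 - s ->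
  k * (k * (A ^+ 2 - B) + B) = s.
Proof.
rewrite -mulrnAl => -> h; rewrite -[s]opprK -[- s](addKr ((k * A) ^+ 2)) -h.
by ring.
Qed.

Lemma polarization (F : comNzRingType) (x y w : F) :
  x ^+ 2 + (w + w) + y ^+ 2 = (x + y) ^+ 2 -> w + w = 2 * (x * y).
Proof.
move=> h; have -> : w + w = x ^+ 2 + (w + w) + y ^+ 2 - x ^+ 2 - y ^+ 2 by ring.
by rewrite h; ring.
Qed.

(** Polynomials with constant term 1 are factored by the inverses of their roots;
    the degree of the product may be smaller than a prescribed formal degree,
    which is why this form is preferred to a monic one. *)
Lemma poly_inv_roots (F : closedFieldType) (p : {poly F}) : p`_0 = 1 ->
  exists rs : seq F, [/\ p = \prod_(r <- rs) (1 - r *: 'X),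
    (size rs < size p)%N & forall r, r \in rs -> r != 0 /\ root p r^-1].
Proof.
move=> p0; have [zs pE] := closed_field_poly_normal p.
have pn0 : p != 0 by apply: contra_eq_neq p0 => ->; rewrite coef0 eq_sym oner_neq0.
have lc0 : lead_coef p != 0 by rewrite lead_coef_eq0.
have rootE z : root p z = (z \in zs) by rewrite pE rootZ // root_prod_XsubC.
have z0 z : z \in zs -> z != 0.
  rewrite -rootE; apply: contraTneq => ->.
  by rewrite /root horner_coef0 p0 oner_neq0.
have [c cE] : exists c, p = c *: \prod_(r <- [seq z^-1 | z <- zs]) (1 - r *: 'X).
  suff [c cE] : exists c, \prod_(z <- zs) ('X - z%:P) =
      c *: \prod_(r <- [seq z^-1 | z <- zs]) (1 - r *: 'X).
    by exists (lead_coef p * c); rewrite {1}pE cE scalerA.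
  elim: zs z0 {pE rootE} => [|z zs IH] z0.
    by exists 1; rewrite !big_nil scale1r.
  have [|c cE] := IH; first by move=> y yz; rewrite z0 // inE yz orbT.
  have zE : 'X - z%:P = - z *: (1 - z^-1 *: 'X).
    rewrite scalerBr scalerA mulNr mulfV ?z0 ?mem_head // scaleN1r opprK.
    by rewrite scaleNr alg_polyC addrC.
  exists (- z * c); rewrite /= !big_cons cE zE.
  by rewrite -scalerAl -scalerAr scalerA.
exists [seq z^-1 | z <- zs]; split.
- have [d0 _ _] := coef012_prod [seq z^-1 | z <- zs].
  move: p0; rewrite {1}cE coefZ d0 mulr1 => c1.
  by rewrite {1}cE c1 scale1r.
- by rewrite size_map pE size_scale // size_prod_XsubC.
- move=> r /mapP[z zz ->]; split; first by rewrite invr_neq0 // z0.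
  by rewrite invrK rootE.
Qed.

Section GleasonKahaneZelazko.
Variables (R : realType) (n : nat).
Notation C := (Cx R).
Variables (S : set 'rV[C]_n) (X : banach_fun_space S).
Hypotheses (X_Q1 : Q1 X) (X_Q2 : Q2 X) (X_Q3 : Q3 X).
Variable one : X.
Hypothesis oneP : represents one (fun=> 1).
Implicit Types (p q : mpoly.mpoly n C).

Local Notation pm := (pmul X_Q3).

Lemma poly_vectorE p (f : X) : represents f (peval p) -> f = pm p one.
Proof. by move=> h; apply: fval_inj => z Sz; rewrite h // pmulE // oneP // mulr1. Qed.

Lemma one_cyclic : cyclic_vector one.
Proof.
apply/(cyclicP X_Q3) => x e e0.
have [y [[p yp] hy]] := denseP (proj2 X_Q1) x e0.
by exists p; rewrite -(poly_vectorE yp).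
Qed.

Lemma cyclic_power q (M : R) (mu : C) k : 0 <= M ->
  (forall g, nm (pm q g) <= M * nm g) -> nm (mu : C^o) * M <= 2^-1 ->
  cyclic_vector (pm ((1 - mu *: q) ^+ k) one).
Proof.
move=> M0 hM hmu; elim: k => [|k IH].
  by rewrite expr0 pmul1; exact: one_cyclic.
rewrite exprS -pmulA; apply: cyclic_perturb IH; [|exact: hmu|].
  by rewrite mulr_ge0 // nm_ge0.
by move=> g; rewrite pmulZl nmZ -mulrA ler_wpM2l // nm_ge0.
Qed.

Variable L : {linear X -> C^o}.
Hypothesis L_bounded : bounded_map L.
Hypothesis L_one : L one = 1.
Hypothesis L_cyclic : forall f, cyclic_vector f -> L f != 0.

Definition Lpoly p : C := L (pm p one).

Lemma LpolyD p q : Lpoly (p + q) = Lpoly p + Lpoly q.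
Proof. by rewrite /Lpoly pmulDl; exact: (raddfD L). Qed.

Lemma LpolyZ c p : Lpoly (c *: p) = c * Lpoly p.
Proof. by rewrite /Lpoly pmulZl; exact: (linearZ_LR L). Qed.

Lemma Lpoly1 : Lpoly 1 = 1.
Proof. by rewrite /Lpoly pmul1. Qed.

Lemma Lpoly0 : Lpoly 0 = 0.
Proof. by rewrite -(scale0r (1 : mpoly.mpoly n C)) LpolyZ mul0r. Qed.

Lemma Lpoly_sum (I : Type) (r : seq I) (P : pred I) (F : I -> mpoly.mpoly n C) :
  Lpoly (\sum_(i <- r | P i) F i) = \sum_(i <- r | P i) Lpoly (F i).
Proof. exact: (big_morph Lpoly LpolyD Lpoly0). Qed.

(** Let M bound the multiplication by q.  The roots of
    psi(mu) = L((1 - mu q)^k) stay away from 0 independently of k, because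
    (1 - mu q)^k is cyclic for small mu.  Their inverses r_i satisfy
    |r_i| <= 2M, and there are at most k of them.  Comparing the first
    coefficients of psi with the power sums of the r_i gives
      k^2 L(q)^2 - k (k - 1) L(q^2) = sum of the r_i^2 = O(k),
    and dividing by k^2 leaves, as k grows, L(q)^2 = L(q^2). *)
Lemma Lpoly_sqr q : Lpoly (q ^+ 2) = Lpoly q ^+ 2.
Proof.
have [M [M0 hM]] := pmul_bounded X_Q3 q.
pose A := Lpoly q; pose B := Lpoly (q ^+ 2).
have key k : (0 < k)%N ->
    nm (A ^+ 2 - B : C^o) * k%:R <= 4 * M ^+ 2 + nm (B : C^o).
  move=> k0.
  pose psi := \poly_(j < k.+1) ('C(k, j)%:R * (-1) ^+ j * Lpoly (q ^+ j)).
  have psic j : psi`_j = 'C(k, j)%:R * (-1) ^+ j * Lpoly (q ^+ j).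
    rewrite coef_poly ltnS; case: leqP => // kj.
    by rewrite bin_small // !mul0r.
  have psiE mu : psi.[mu] = Lpoly ((1 - mu *: q) ^+ k).
    rewrite horner_poly -scaleNr exprDn Lpoly_sum; apply: eq_bigr => j _.
    rewrite expr1n mul1r exprZn -[X in _ = Lpoly X]scaler_nat !LpolyZ (exprNn mu).
    by rewrite -!mulrA [Lpoly _ * _]mulrC.
  have [|rs [psiF size_rs root_rs]] := @poly_inv_roots C psi.
    by rewrite psic bin0 !expr0 Lpoly1 !mulr1.
  have [_ c1 c2] := coef012_prod rs.
  rewrite -psiF !psic bin1 expr1 in c1 c2.
  have size_rs' : (size rs <= k)%N.
    by rewrite -ltnS (leq_trans size_rs) // size_poly.
  have rs_le r : r \in rs -> nm (r : C^o) <= 2 * M.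
    move=> /root_rs[r0 /eqP]; rewrite psiE => h; rewrite leNgt; apply/negP => Mr.
    have : cyclic_vector (pm ((1 - r^-1 *: q) ^+ k) one).
      apply: (cyclic_power _ M0 hM).
      rewrite nmV ler_pdivrMl ?nm_neq0 //; lra.
    by move/L_cyclic; rewrite -/(Lpoly _) h eqxx.
  have sum_le : nm (\sum_(r <- rs) r ^+ 2 : C^o) <= k%:R * (4 * M ^+ 2).
    rewrite (le_trans (nm_sum _ _ _)) //.
    rewrite (@le_trans _ _ (\sum_(r <- rs) (4 * M ^+ 2))) //.
      rewrite big_seq [leRHS]big_seq; apply: ler_sum => r rr.
      have := rs_le r rr; have := @nm_ge0 _ C^o r; rewrite nmX; nra.
    rewrite big_const_seq count_predT iter_addr_0 -[_ *+ _]mulr_natl.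
    by rewrite ler_wpM2r ?ler_nat // mulr_ge0 // exprn_ge0.
  have E : k%:R * (k%:R * (A ^+ 2 - B) + B) = \sum_(r <- rs) r ^+ 2.
    have E1 : \sum_(r <- rs) r = k%:R * A.
      by rewrite -[LHS]opprK -c1 mulrN1 mulNr opprK.
    have E2 : 'C(k, 2)%:R *+ 2 = k%:R * (k%:R - 1) :> C.
      rewrite -mulrnA mulnC -[2%N]/(1.+1) -mul_bin_diag bin1.
      by case: (k) k0 => // k' _; rewrite natrM /= -natr1 addrK.
    apply: (square_sum_identity E2).
    by rewrite -E1 -c2 sqrrN expr1n mulr1.
  have kR : 0 < k%:R :> R by rewrite ltr0n.
  rewrite -(ler_pM2l kR) mulrDr.
  have -> : k%:R * (nm (A ^+ 2 - B : C^o) * k%:R) =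
      nm (k%:R * (k%:R * (A ^+ 2 - B)) : C^o) by rewrite !nmM nm_nat; ring.
  have -> : k%:R * (k%:R * (A ^+ 2 - B)) =
      \sum_(r <- rs) r ^+ 2 - k%:R * B by rewrite -E [in RHS]mulrDr addrK.
  by rewrite (le_trans (nmB _ _)) // nmM nm_nat lerD2r.
apply/esym/(@nm_eq _ C^o) => e e0; rewrite leNgt; apply/negP => he.
pose K := (4 * M ^+ 2 + nm (B : C^o)) / e.
have := key _ (ltn0Sn (Num.truncn K)); have := truncnS_gt K.
rewrite {1}/K ltr_pdivrMr // -/A -/B in he * => h1 h2.
have := ltr0Sn R (Num.truncn K); nra.
Qed.

Lemma LpolyM p q : Lpoly (p * q) = Lpoly p * Lpoly q.
Proof.
have two0 : (2 : C) != 0 by rewrite pnatr_eq0.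
apply: (mulfI two0).
have := Lpoly_sqr (p + q); rewrite sqrrD mulr2n !LpolyD !Lpoly_sqr.
by rewrite mulrDl mul1r => /polarization.
Qed.

Lemma Lpoly_peval p (b := \row_i Lpoly (mpoly.mpolyX C (mpoly.mnm1 i))) :
  Lpoly p = peval p b.
Proof.
elim/mpoly.mpolyind: p => [|c m p _ _ IH]; first by rewrite Lpoly0 peval0.
rewrite LpolyD LpolyZ pevalD pevalZ IH; congr (_ * _ + _).
rewrite pevalX mpoly.mpolyXE_id (big_morph Lpoly LpolyM Lpoly1); apply: eq_bigr => i _.
rewrite /b mxE; elim: (m i) => [|j IHj]; first by rewrite !expr0 Lpoly1.
by rewrite !exprS LpolyM IHj.
Qed.

(** By polarization L is multiplicative on polynomials, so it evaluates them at
    the point b whose coordinates are the values of L at the coordinate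
    functions.  The maximality of the domain puts b in S, and density of the
    polynomials extends the identity to all of X. *)
Theorem gleason_kahane_zelazko :
  exists2 b, S b & forall f : X, L f = fval f b.
Proof.
pose b := \row_i Lpoly (mpoly.mpolyX C (mpoly.mnm1 i)); exists b.
  apply: (proj2 X_Q2 b L L_bounded) => p f /poly_vectorE ->.
  exact: Lpoly_peval.
have Sb : S b.
  apply: (proj2 X_Q2 b L L_bounded) => p f /poly_vectorE ->.
  exact: Lpoly_peval.
move=> f; have [M [M0 hM]] := proj1 (boundedP _) L_bounded.
have [N [N0 hN]] := proj1 (boundedP _) (proj1 X_Q2 b Sb).
apply: (@nm_eq _ C^o) => e e0.
have MN : 0 < M + N + 1 by lra.
have [p hp] := proj1 (cyclicP X_Q3 one) one_cyclic f _ (divr_gt0 e0 MN).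
have E : L (pm p one) = fval (pm p one) b.
  by rewrite -/(Lpoly p) Lpoly_peval pmulE // oneP // mulr1.
rewrite (le_trans (nm_trans (L (pm p one) : C^o) _ _)) // {2}E.
rewrite [X in X + _](_ : _ = nm (L (f - pm p one))); last by rewrite raddfB.
rewrite [X in _ + X](_ : _ = nm (fval (f - pm p one) b : C^o)); last first.
  by rewrite fvalB // nmC.
have := hM (f - pm p one); have := hN (f - pm p one).
move: hp; rewrite ltr_pdivlMr //.
have := nm_ge0 (f - pm p one); nra.
Qed.

End GleasonKahaneZelazko.

(** * Cauchy's estimates for polynomials *)

Section RootsOfUnity.
Variable R : realType.
Notation C := (Cx R).

Lemma prim_root_exists N : (0 < N)%N -> exists z : C, N.-primitive_root z.
Proof.
move=> N0; pose p : {poly C} := 'X^N - 1.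
have [r Dp] := closed_field_poly_normal p.
rewrite (monicP _) ?monicXnsubC // scale1r in Dp.
have rn1: all N.-unity_root r by apply/allP=> z; rewrite -root_prod_XsubC -Dp.
have sz_r: (N < (size r).+1)%N.
  by rewrite -(size_prod_XsubC r id) -Dp size_XnsubC.
have [|z] := hasP (cyclic.has_prim_root N0 rn1 _ sz_r); last by exists z.
rewrite -separable.separable_prod_XsubC -Dp.
by rewrite cyclotomic.separable_Xn_sub_1 // pnatr_eq0 -lt0n.
Qed.

Lemma sum_unity_roots N (z : C) d : N.-primitive_root z ->
  \sum_(l < N) z ^+ (l * d) = if (N %| d)%N then N%:R else 0.
Proof.
move=> hz; case: ifP => [Nd|Nd].
  transitivity (\sum_(l < N) (1 : C)).
    apply: eq_bigr => l _; apply/eqP.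
    by rewrite -(prim_order_dvd hz) dvdn_mull.
  by rewrite sumr_const card_ord.
have : (z ^+ d - 1) * \sum_(l < N) (z ^+ d) ^+ l = 0.
  by rewrite -subrX1 -exprM mulnC exprM (prim_expr_order hz) expr1n subrr.
move=> /eqP; rewrite mulf_eq0 subr_eq0 -(prim_order_dvd hz) Nd /= => /eqP h.
by rewrite -[RHS]h; apply: eq_bigr => l _; rewrite -exprM mulnC.
Qed.

Lemma nm_prim_root N (z : C) : N.-primitive_root z -> nm (z : C^o) = 1.
Proof.
move=> hz; have N0 := prim_order_gt0 hz.
apply/eqP; rewrite -(@pexpr_eq1 _ _ N) ?nm_ge0 //.
by rewrite -nmX (prim_expr_order hz) nm1.
Qed.

End RootsOfUnity.

Section GeometricSums.
Variable R : realType.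

Lemma sum_half N : \sum_(j < N) 2^-1 ^+ j <= 2 :> R.
Proof.
suff -> : \sum_(j < N) 2^-1 ^+ j = 2 - 2 * 2^-1 ^+ N :> R.
  by rewrite gerBl mulr_ge0 // exprn_ge0 // invr_ge0.
elim: N => [|N IH]; first by rewrite big_ord0 expr0; ring.
by rewrite big_ord_recr /= IH exprS; field.
Qed.

(** Multi-indices embed into finite grids, over which the sum of 2^-|a| factors
    into n geometric sums. *)
Lemma sum_half_mdeg n (s : seq (mpoly.multinom n)) : uniq s ->
  \sum_(a <- s) 2^-1 ^+ mpoly.mdeg a <= 2 ^+ n :> R.
Proof.
move=> us; pose N := (\max_(a <- s) mpoly.mdeg a)%N.
have aN a i : a \in s -> (a i < N.+1)%N.
  move=> sa; rewrite ltnS (leq_trans _ (leq_bigmax_seq _ sa _)) //.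
  by rewrite mpoly.mdegE (bigD1 i) //= leq_addr.
pose phi (a : mpoly.multinom n) : {ffun 'I_n -> 'I_N.+1} := [ffun i => inord (a i)].
pose G (l : {ffun 'I_n -> 'I_N.+1}) : R := \prod_i 2^-1 ^+ l i.
have -> : \sum_(a <- s) 2^-1 ^+ mpoly.mdeg a = \sum_(l <- map phi s) G l.
  rewrite big_map; apply: eq_big_seq => a sa.
  rewrite mpoly.mdegE expr_sum; apply: eq_bigr => i _.
  by rewrite ffunE inordK // aN.
have G0 l : 0 <= G l.
  by apply: prodr_ge0 => i _; rewrite exprn_ge0 // invr_ge0.
apply: (@le_trans _ _ (\sum_l G l)).
  rewrite big_uniq /= ?big_mkcond; last first.
    rewrite map_inj_in_uniq // => a b sa sb /ffunP h.
    apply/mpoly.mnmP => i; have := congr1 val (h i).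
    by rewrite !ffunE /= !inordK // aN.
  by apply: ler_sum => l _; case: ifP.
rewrite -(bigA_distr_bigA (fun _ (j : 'I_N.+1) => 2^-1 ^+ j)).
rewrite -[X in _ <= _ ^+ X](card_ord n) -prodr_const.
by apply: ler_prod => i _; rewrite sum_half sumr_ge0.
Qed.

End GeometricSums.

Section Polynomials.
Variable R : realType.
Notation C := (Cx R).

Lemma nm_monomial n (w : 'rV[C]_n) (s : R) a :
  (forall i, nm (w 0 i : C^o) <= s) -> nm (monomial w a : C^o) <= s ^+ mpoly.mdeg a.
Proof.
move=> hw; rewrite nm_prod mpoly.mdegE expr_sum.
apply: ler_prod => i _; rewrite nm_ge0 nmX /=.
apply: lerXn2r; rewrite ?nnegrE ?nm_ge0 ?hw //; exact: le_trans (nm_ge0 _) (hw i).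
Qed.

Lemma pevalE n (p : mpoly.mpoly n C) w :
  peval p w = \sum_(a <- mpoly.msupp p) mpoly.mcoeff a p * monomial w a.
Proof. exact: mpoly.mevalE. Qed.

Lemma sum_mcoeff_delta n (p : mpoly.mpoly n C) b :
  \sum_(a <- mpoly.msupp p) mpoly.mcoeff a p * (a == b)%:R = mpoly.mcoeff b p.
Proof.
rewrite [in RHS](mpoly.mpolyE p) raddf_sum /=.
by apply: eq_bigr => a _; rewrite mpoly.mcoeffZ mpoly.mcoeffX.
Qed.

Lemma peval_at0 n (p : mpoly.mpoly n C) : peval p 0 = mpoly.mcoeff mpoly.mnm0 p.
Proof.
rewrite pevalE -sum_mcoeff_delta; apply: eq_bigr => a _; congr (_ * _).
case: eqP => [->|/eqP ne].
  by rewrite /monomial big1 // => i _; rewrite mpoly.mnm0E expr0.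
have /existsP[i ai] : [exists i, a i != 0%N].
  apply: contraNT ne; rewrite negb_exists => /forallP h.
  by apply/eqP/mpoly.mnmP => i; rewrite mpoly.mnm0E; apply/eqP/negbNE.
by rewrite /monomial (bigD1 i) //= mxE expr0n (negbTE ai) mul0r.
Qed.

Lemma peval_subst n k (lq : 'I_n -> mpoly.mpoly k C) (p : mpoly.mpoly n C) :
  exists p', forall t, peval p' t = peval p (\row_i peval (lq i) t).
Proof.
exists (mpoly.comp_mpoly [tuple lq i | i < n] p) => t.
rewrite /peval mpoly.comp_mpoly_meval; apply: mpoly.meval_eq => i.
by rewrite tnth_mktuple mxE.
Qed.

Lemma peval_translate n (u : 'rV[C]_n) (p : mpoly.mpoly n C) :
  exists p', forall w, peval p' w = peval p (u + w).
Proof.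
have [p' hp'] := peval_subst
  (fun i => u 0 i *: 1 + mpoly.mpolyX C (mpoly.mnm1 i)) p.
exists p' => w; rewrite hp'; congr (peval p _).
by apply/rowP => i; rewrite !mxE pevalD pevalZ peval1 pevalU mulr1.
Qed.

Lemma peval_line n (u v : 'rV[C]_n) (p : mpoly.mpoly n C) :
  exists p' : mpoly.mpoly 1 C, forall t, peval p' t = peval p (u + t 0 0 *: v).
Proof.
have [p' hp'] := peval_subst
  (fun i => u 0 i *: 1 + v 0 i *: mpoly.mpolyX C (mpoly.mnm1 (0 : 'I_1))) p.
exists p' => w; rewrite hp'; congr (peval p _).
by apply/rowP => i; rewrite !mxE pevalD !pevalZ peval1 pevalU mulr1 mulrC.
Qed.

(** For N larger than all the exponents that occur, averaging
    p(rho zeta^l) zeta^(- a l) over the grid of N-th roots of unity extracts the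
    coefficient of index a exactly, as a Cauchy integral over a torus would. *)
Lemma cauchy_estimate n (p : mpoly.mpoly n C) (rho B : R) a : 0 <= rho ->
  (forall z : 'rV[C]_n, (forall i, nm (z 0 i : C^o) = rho) ->
     nm (peval p z : C^o) <= B) ->
  nm (mpoly.mcoeff a p : C^o) * rho ^+ mpoly.mdeg a <= B.
Proof.
move=> rho0 hB; pose N := (mpoly.msize p + mpoly.mdeg a).+1.
have N0 : 0 < N%:R :> R by rewrite ltr0n.
have [zeta hz] := @prim_root_exists R N isT.
have ltN b i : (mpoly.mdeg b <= mpoly.msize p + mpoly.mdeg a)%N -> (b i < N)%N.
  move=> hb; rewrite ltnS (leq_trans _ hb) //.
  by rewrite mpoly.mdegE (bigD1 i) //= leq_addr.
have aN i : (a i < N)%N by rewrite ltN // leq_addl.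
pose z (l : {ffun 'I_n -> 'I_N}) : 'rV[C]_n := \row_i (toC rho * zeta ^+ l i).
(* N - a i stands for the exponent - a i, to stay in the natural numbers *)
pose chi (l : {ffun 'I_n -> 'I_N}) : C := \prod_i zeta ^+ (l i * (N - a i)).
have E : \sum_l peval p (z l) * chi l =
    mpoly.mcoeff a p * (toC rho ^+ mpoly.mdeg a * N%:R ^+ n).
  rewrite -sum_mcoeff_delta mulr_suml.
  under eq_bigr => l _ do rewrite pevalE mulr_suml.
  rewrite exchange_big; apply: eq_big_seq => b bp /=.
  under eq_bigr => l _ do rewrite -mulrA.
  rewrite -mulr_sumr -mulrA; congr (_ * _).
  have bN i : (b i < N)%N.
    by rewrite ltN // (leq_trans (ltnW (mpoly.msize_mdeg_lt bp))) // leq_addr.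
  transitivity (\sum_(l : {ffun 'I_n -> 'I_N})
     \prod_i (toC rho ^+ b i * zeta ^+ (l i * (b i + (N - a i))))).
    apply: eq_bigr => l _; rewrite -big_split; apply: eq_bigr => i _ /=.
    by rewrite mxE exprMn -mulrA -exprM -exprD mulnDr.
  rewrite -(bigA_distr_bigA (fun i (l : 'I_N) =>
     toC rho ^+ b i * zeta ^+ (l * (b i + (N - a i))))).
  under eq_bigr => i _ do rewrite -mulr_sumr (sum_unity_roots _ hz).
  case: eqP => [->|/eqP ne]; rewrite ?mul1r ?mul0r.
    rewrite mpoly.mdegE expr_sum.
    rewrite -[X in _ * N%:R ^+ X](card_ord n) -prodr_const -big_split.
    by apply: eq_bigr => i _; rewrite subnKC ?dvdnn // ltnW.
  have /existsP[i ai] : [exists i, b i != a i].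
    apply: contraNT ne; rewrite negb_exists => /forallP h.
    by apply/eqP/mpoly.mnmP => i; apply/eqP/negbNE.
  rewrite (bigD1 i) //= ifN ?mulr0 ?mul0r //.
  apply: contra ai => /dvdnP[c hc]; have := aN i; have := bN i.
  move: hc; rewrite addnBA ?(ltnW (aN i)) // => hc b1 a1.
  have : (b i + N = c * N + a i)%N.
    by rewrite -hc subnK // (leq_trans (ltnW a1)) // leq_addl.
  move=> {}hc; have := congr1 (modn^~ N) hc.
  by rewrite modnDr modnMDl !modn_small // => ->.
have : nm (\sum_l peval p (z l) * chi l : C^o) <= B * N%:R ^+ n.
  rewrite (le_trans (nm_sum _ _ _)) //.
  apply: (@le_trans _ _ (\sum_(l : {ffun 'I_n -> 'I_N}) B)).
    apply: ler_sum => l _; rewrite nmM nm_prod big1 ?mulr1.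
      apply: hB => i; rewrite mxE nmM nmX (nm_prim_root hz) expr1n mulr1.
      by rewrite nm_toC ger0_norm.
    by move=> i _; rewrite nmX (nm_prim_root hz) expr1n.
  by rewrite sumr_const card_ffun !card_ord -[leLHS]mulr_natr natrX.
rewrite E !nmM !nmX nm_nat nm_toC ger0_norm // mulrA ler_pM2r //.
by rewrite exprn_gt0.
Qed.

(** The maximum principle at the centre of a disc: the value there is the constant
    coefficient of the restriction of p to the line, to which Cauchy's estimate
    applies. *)
Lemma max_on_line n (p : mpoly.mpoly n C) (u v : 'rV[C]_n) (rho B : R) :
  0 <= rho ->
  (forall t : C, nm (t : C^o) = rho -> nm (peval p (u + t *: v) : C^o) <= B) ->
  nm (peval p u : C^o) <= B.
Proof.
move=> rho0 hB; have [p' hp'] := peval_line u v p.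
have := @cauchy_estimate 1 p' rho B mpoly.mnm0 rho0.
rewrite mpoly.mdeg0 expr0 mulr1 -peval_at0 hp' mxE scale0r addr0; apply.
by move=> z hz; rewrite hp' hB.
Qed.

Lemma monomial_sum_bound n (s : seq (mpoly.multinom n)) (d : mpoly.multinom n -> C)
    (K r : R) (w : 'rV[C]_n) : uniq s -> 0 < r ->
  (forall a, a \in s -> nm (d a : C^o) * r ^+ mpoly.mdeg a <= K) ->
  (forall i, nm (w 0 i : C^o) <= r / 2) ->
  0 <= K ->
  nm (\sum_(a <- s) d a * monomial w a : C^o) <= K * 2 ^+ n.
Proof.
move=> us r0 hd hw K0; rewrite (le_trans (nm_sum _ _ _)) //.
apply: (@le_trans _ _ (\sum_(a <- s) K * 2^-1 ^+ mpoly.mdeg a)).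
  rewrite big_seq [leRHS]big_seq; apply: ler_sum => a sa.
  have := nm_monomial a hw; rewrite nmM => h.
  rewrite (le_trans (ler_wpM2l (nm_ge0 _) h)) // exprMn mulrA.
  by rewrite ler_wpM2r ?hd // exprn_ge0 // invr_ge0.
by rewrite -mulr_sumr ler_wpM2l // sum_half_mdeg.
Qed.

(** Scaled to radius 2 rho, the coefficients of degree at most J are bounded by
    e (2 rho / delta)^J and the others by B 2^-J: these are Cauchy's estimates
    on the two tori.  With B fixed, p is small on the polydisc of radius rho when
    e is small enough, which is the quantitative form of the identity
    theorem. *)
Lemma two_constants n (p : mpoly.mpoly n C) (rho delta B e : R) J (w : 'rV[C]_n) :
  0 < delta -> delta <= 2 * rho -> 0 <= e -> 0 <= B ->
  (forall z : 'rV[C]_n, (forall i, nm (z 0 i : C^o) = delta) ->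
     nm (peval p z : C^o) <= e) ->
  (forall z : 'rV[C]_n, (forall i, nm (z 0 i : C^o) = 4 * rho) ->
     nm (peval p z : C^o) <= B) ->
  (forall i, nm (w 0 i : C^o) <= rho) ->
  nm (peval p w : C^o) <= (e * (2 * rho / delta) ^+ J + B * 2^-1 ^+ J) * 2 ^+ n.
Proof.
move=> d0 drho e0 B0 he hB hw; have rho0 : 0 < rho by lra.
have q1 : 1 <= 2 * rho / delta by rewrite ler_pdivlMr // mul1r.
rewrite pevalE; apply: (@monomial_sum_bound _ _ _ _ (2 * rho)).
- exact: mpoly.msupp_uniq.
- by lra.
- move=> a _; case: (leqP (mpoly.mdeg a) J) => aJ.
    have E : 2 * rho = delta * (2 * rho / delta).
      by rewrite mulrCA divff ?mulr1 // gt_eqF.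
    rewrite {1}E exprMn mulrA -[leLHS]addr0 lerD //.
      apply: ler_pM => //.
      - by apply: mulr_ge0; rewrite ?nm_ge0 // exprn_ge0 // ltW.
      - by apply: exprn_ge0; exact: le_trans q1.
      - by apply: cauchy_estimate => //; exact: ltW.
      - exact: ler_weXn2l.
    by apply: mulr_ge0 => //; apply: exprn_ge0; rewrite invr_ge0.
  have E : 2 * rho = (4 * rho) * 2^-1 by lra.
  rewrite {1}E exprMn mulrA -[leLHS]add0r lerD //.
    by apply: mulr_ge0 => //; apply: exprn_ge0; exact: le_trans q1.
  apply: ler_pM => //.
  - by apply: mulr_ge0; rewrite ?nm_ge0 // exprn_ge0 //; lra.
  - by apply: cauchy_estimate => //; lra.
  - by apply: ler_wiXn2l => //; [lra | exact: ltnW].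
- by move=> i; rewrite (le_trans (hw i)) //; lra.
- by apply: addr_ge0; apply: mulr_ge0 => //; apply: exprn_ge0; exact: le_trans q1.
Qed.

End Polynomials.

(** * Power series and uniform limits of polynomials *)

Section Analytic.
Variables (R : realType) (n : nat).
Notation C := (Cx R).
Notation mnm := (mpoly.multinom n).
Implicit Types (p : mpoly.mpoly n C) (u w x y : 'rV[C]_n) (c : mnm -> C).

Definition polydisc (r : R) w := forall i, nm (w 0 i : C^o) <= r.

Definition power_sum c w (A : {fset mnm}) : C :=
  \sum_(a <- A) c a * monomial w a.

(** Power series are centred at 0; a function is translated when it is to be
    expanded at another point. *)
Definition expansion c (r : R) (g : 'rV[C]_n -> C) :=
  forall w, polydisc r w -> power_sum c w @ totally --> g w.

Definition trunc J c : mpoly.mpoly n C :=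
  \sum_(m : mpoly.bmultinom n J) c m *: mpoly.mpolyX C (mpoly.bmnm m).

Lemma polydisc_le r s w : r <= s -> polydisc r w -> polydisc s w.
Proof. by move=> rs h i; rewrite (le_trans (h i)). Qed.

Lemma polydiscD r s w w' : polydisc r w -> polydisc s w' -> polydisc (r + s) (w + w').
Proof. by move=> h h' i; rewrite mxE (le_trans (nmD _ _)) // lerD. Qed.

Lemma polydiscN r w : polydisc r w -> polydisc r (- w).
Proof. by move=> h i; rewrite mxE (@nmN _ C^o). Qed.

Lemma polydiscZ r w (t : C) : polydisc r w -> polydisc (nm (t : C^o) * r) (t *: w).
Proof. by move=> h i; rewrite mxE nmM ler_wpM2l // nm_ge0. Qed.

Lemma polydisc0 r : 0 <= r -> polydisc r 0.
Proof. by move=> r0 i; rewrite mxE nm0. Qed.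

Lemma analytic_expansion (E : set 'rV[C]_n) f u : analytic_on E f -> E u ->
  exists c r, 0 < r /\ expansion c r (fun w => f (u + w)).
Proof.
move=> fan Eu; have [c /near_rowP[r [r0 hr]]] := fan u Eu.
exists c, (r / 2); split=> [|w hw]; first by rewrite divr_gt0.
have {1}-> : power_sum c w = fun A => \sum_(a <- A) c a * monomial (u + w - u) a.
  by rewrite addrC addKr.
apply: hr => i; rewrite mxE addrAC subrr add0r (le_lt_trans (hw i)) //; lra.
Qed.

Lemma mcoeff_trunc J c a :
  mpoly.mcoeff a (trunc J c) = if (mpoly.mdeg a < J)%N then c a else 0.
Proof.
rewrite /trunc raddf_sum /=.
under eq_bigr => m _ do rewrite mpoly.mcoeffZ mpoly.mcoeffX.
case: ifP => [aJ|/negbT aJ].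
  rewrite (bigD1 (mpoly.BMultinom aJ)) //= eqxx mulr1 big1 ?addr0 // => m ne.
  rewrite (_ : _ == a = false) ?mulr0 //.
  by apply: contraNF ne => /eqP ma; apply/eqP/val_inj.
rewrite big1 // => m _; rewrite (_ : _ == a = false) ?mulr0 //.
by apply: contraNF aJ => /eqP <-; exact: mpoly.bmdeg.
Qed.

Lemma peval_fset p (A : {fset mnm}) w : {subset mpoly.msupp p <= A} ->
  peval p w = \sum_(a <- A) mpoly.mcoeff a p * monomial w a.
Proof.
move=> sub; rewrite pevalE [RHS](bigID (mem (mpoly.msupp p))) /=.
rewrite [X in _ + X]big1 ?addr0 => [|a ap]; last first.
  by rewrite mpoly.memN_msupp_eq0 ?mul0r.
rewrite -[RHS]big_filter; apply: perm_big; apply: uniq_perm.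
- exact: mpoly.msupp_uniq.
- by rewrite filter_uniq // fset_uniq.
- move=> a; rewrite mem_filter /=.
  by case: (boolP (a \in mpoly.msupp p)) => //= /sub.
Qed.

(** The terms of an unconditionally convergent series are bounded: outside a finite
    set they are differences of two partial sums close to the limit.  This is
    used at the corner of the polydisc, where |w^a| = r^|a|. *)
Lemma expansion_coef c r g : 0 < r -> expansion c r g ->
  exists K, 0 <= K /\ forall a, nm (c a : C^o) * r ^+ mpoly.mdeg a <= K.
Proof.
move=> r0 h; pose w : 'rV[C]_n := const_mx (toC r).
have wm a : nm (monomial w a : C^o) = r ^+ mpoly.mdeg a.
  rewrite nm_prod mpoly.mdegE expr_sum; apply: eq_bigr => i _.
  by rewrite nmX mxE nm_toC gtr0_norm.
have hw : polydisc r w by move=> i; rewrite mxE nm_toC gtr0_norm.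
have /totally_cvgP /(_ 1 ltr01)[A0 hA] := h w hw.
have S0 : 0 <= \sum_(a <- A0) nm (c a : C^o) * r ^+ mpoly.mdeg a.
  by apply: sumr_ge0 => a _; rewrite mulr_ge0 ?nm_ge0 // exprn_ge0 // ltW.
exists (2 + \sum_(a <- A0) nm (c a : C^o) * r ^+ mpoly.mdeg a).
split=> [|a]; first by rewrite addr_ge0.
have [aA|aA] := boolP (a \in A0).
  rewrite (big_fsetD1 a) //= addrCA lerDl addr_ge0 //.
  by apply: sumr_ge0 => b _; rewrite mulr_ge0 ?nm_ge0 // exprn_ge0 // ltW.
have h1 := hA _ (fsubset_refl A0); have h2 := hA _ (fsubsetU1 a A0).
rewrite -[leLHS]addr0 lerD // -wm -nmM.
have -> : c a * monomial w a = power_sum c w (a |` A0)%fset - power_sum c w A0.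
  by rewrite /power_sum big_fsetU1 //= addrK.
rewrite (le_trans (nm_trans (g w : C^o) _ _)) //.
rewrite [X in _ + X]nmC; lra.
Qed.

(** The tail of degree at least J, compared with a geometric series. *)
Lemma expansion_trunc c r g : 0 < r -> expansion c r g ->
  exists K, 0 <= K /\ forall J s w, 0 < s -> s <= r / 2 -> polydisc s w ->
    nm (g w - peval (trunc J c) w : C^o) <= K * (2 * s / r) ^+ J.
Proof.
move=> r0 h; have [K [K0 hK]] := expansion_coef r0 h.
exists (K * 2 ^+ n); split; first by rewrite mulr_ge0 // exprn_ge0.
move=> J s w s0 sr sw; rewrite mulrAC; apply/ler_addgt0Pr => e e0.
have wr : polydisc r w by apply: polydisc_le sw; lra.
have /totally_cvgP /(_ e e0)[A0 hA] := h w wr.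
pose p := trunc J c; pose A := (A0 `|` [fset a in mpoly.msupp p])%fset.
have := hA A (fsubsetUl _ _); rewrite nmC => hgA.
rewrite (le_trans (nm_trans (power_sum c w A : C^o) _ _)) // addrC lerD //; last exact: ltW.
rewrite (@peval_fset p A w); last by move=> a ap; rewrite !inE ap orbT.
rewrite /power_sum -sumrB; under eq_bigr => a _ do rewrite -mulrBl.
have q0 : 0 <= 2 * s / r by rewrite divr_ge0 // ?ltW // mulr_gt0.
have q1 : 2 * s / r <= 1 by rewrite ler_pdivrMr // mul1r; lra.
apply: (@monomial_sum_bound _ _ _ _ _ (2 * s)).
- exact: fset_uniq.
- by rewrite mulr_gt0.
- move=> a _; rewrite mcoeff_trunc; case: ltnP => aJ.
    by rewrite subrr nm0 mul0r mulr_ge0 // exprn_ge0.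
  rewrite subr0; have E : 2 * s = r * (2 * s / r).
    by rewrite mulrCA divff ?mulr1 // gt_eqF.
  rewrite {1}E exprMn mulrA; apply: ler_pM => //.
  + by rewrite mulr_ge0 ?nm_ge0 // exprn_ge0 // ltW.
  + by rewrite exprn_ge0.
  + by apply: ler_wiXn2l.
- by move=> i; rewrite (le_trans (sw i)) //; lra.
- by rewrite mulr_ge0 // exprn_ge0.
Qed.

(** For functions near 0 this is equivalent to having a power series expansion, up
    to shrinking the polydisc ([expansion_approx], [approx_expansion]), and it is
    the form in which analyticity is used: it is stable under translation and
    uniform limits. *)
Definition poly_approx (r : R) (g : 'rV[C]_n -> C) :=
  forall e : R, 0 < e -> exists p, forall w, polydisc r w ->
    nm (g w - peval p w : C^o) <= e.

Lemma expansion_approx c r g : 0 < r -> expansion c r g ->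
  poly_approx (r / 4) g.
Proof.
move=> r0 h e e0; have [K [K0 hK]] := expansion_trunc r0 h.
have [J /(_ J (leqnn J)) hJ] := half_pow K e0.
exists (trunc J c) => w hw.
have r4 : 0 < r / 4 by rewrite divr_gt0.
rewrite (le_trans (hK J (r / 4) w r4 _ hw)) //; first by lra.
have -> : 2 * (r / 4) / r = 2^-1 by field; rewrite gt_eqF.
by rewrite mulrC ltW.
Qed.

(** Cauchy's estimates make each coefficient of the approximating polynomials a
    Cauchy sequence, with a rate summable over the multi-indices on the polydisc
    of half the radius. *)
Lemma approx_expansion r g : 0 < r -> poly_approx r g ->
  exists c, expansion c (r / 2) g.
Proof.
move=> r0 h.
have hj j : exists p, forall w, polydisc r w -> nm (g w - peval p w : C^o) <= 2^-1 ^+ j.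
  by apply: h; rewrite exprn_gt0 // invr_gt0.
have [p hp] := choice hj.
have h2 j : 0 < 2^-1 ^+ j :> R by rewrite exprn_gt0 // invr_gt0.
have coef i j a : nm (mpoly.mcoeff a (p i) - mpoly.mcoeff a (p j) : C^o)
    * r ^+ mpoly.mdeg a <= 2^-1 ^+ i + 2^-1 ^+ j.
  rewrite -mpoly.mcoeffB; apply: cauchy_estimate; first exact: ltW.
  move=> z hz; have sz : polydisc r z by move=> k; rewrite hz.
  rewrite pevalB (le_trans (nm_trans (g z : C^o) _ _)) // lerD ?hp //.
  by rewrite nmC hp.
have cau a : cauchyR (fun j => mpoly.mcoeff a (p j) : C^o).
  move=> e e0; have ra : 0 < r ^+ mpoly.mdeg a by rewrite exprn_gt0.
  have [N hN] := half_pow 2 (mulr_gt0 e0 ra).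
  exists N => i j Ni Nj; rewrite -(ltr_pM2r ra) (le_lt_trans (coef _ _ _)) //.
  have := hN i Ni; have := hN j Nj; lra.
have [c hc] := choice (fun a => C_complete (cau a)).
have hcj a j : nm (c a - mpoly.mcoeff a (p j) : C^o) * r ^+ mpoly.mdeg a
    <= 2^-1 ^+ j.
  have ra : 0 < r ^+ mpoly.mdeg a by rewrite exprn_gt0.
  rewrite -ler_pdivlMr //; apply/ler_addgt0Pr => e e0.
  have e2 : 0 < e / 2 by lra.
  have [N hN] := hc a _ e2.
  have [N' hN'] := half_pow 1 (mulr_gt0 e2 ra).
  pose i := maxn N N'.
  rewrite (le_trans (nm_trans (mpoly.mcoeff a (p i) : C^o) _ _)) //.
  have := hN i (leq_maxl _ _); rewrite nmC => h1.
  have := coef i j a; rewrite -ler_pdivlMr // mulrDl => h3.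
  have := hN' i (leq_maxr _ _); rewrite mulr1 -ltr_pdivrMr // => h4.
  lra.
exists c => w hw; apply/totally_cvgP => e e0.
have [j /(_ j (leqnn j)) hj'] := half_pow (2 ^+ n + 1) e0.
exists [fset a in mpoly.msupp (p j)]%fset => A /fsubsetP sub.
have hwr : polydisc r w by apply: polydisc_le hw; lra.
rewrite (le_lt_trans _ hj') // mulrDr mulr1.
rewrite (le_trans (nm_trans (peval (p j) w : C^o) _ _)) //; apply: lerD.
  rewrite (@peval_fset _ A); last by move=> a ap; apply: sub; rewrite !inE.
  rewrite /power_sum -sumrB; under eq_bigr => a _ do rewrite -mulrBl.
  by apply: (monomial_sum_bound (fset_uniq A) r0).
by rewrite nmC hp.
Qed.

Lemma peval_bounded p r : 0 <= r -> exists B, 0 <= B /\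
  forall w, polydisc r w -> nm (peval p w : C^o) <= B.
Proof.
move=> r0.
exists (\sum_(a <- mpoly.msupp p) nm (mpoly.mcoeff a p : C^o) * r ^+ mpoly.mdeg a).
split=> [|w hw].
  by apply: sumr_ge0 => a _; rewrite mulr_ge0 ?nm_ge0 // exprn_ge0.
rewrite pevalE (le_trans (nm_sum _ _ _)) //; apply: ler_sum => a _.
by rewrite nmM ler_wpM2l ?nm_ge0 // nm_monomial.
Qed.

Lemma peval_continuous p u (e : R) : 0 < e ->
  exists d, [/\ 0 < d, d <= 1 & forall y, polydisc d y ->
    nm (peval p (u + y) - peval p u : C^o) <= e].
Proof.
move=> e0; have [p' hp'] := peval_translate u p.
pose q := p' - peval p u *: 1.
have qE y : peval q y = peval p (u + y) - peval p u.
  by rewrite pevalB pevalZ peval1 mulr1 hp'.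
have q0 : mpoly.mcoeff mpoly.mnm0 q = 0.
  by rewrite -peval_at0 qE addr0 subrr.
pose M := \sum_(a <- mpoly.msupp q) nm (mpoly.mcoeff a q : C^o).
have M0 : 0 <= M by apply: sumr_ge0 => a _; exact: nm_ge0.
pose d := Num.min 1 (e / (M + 1)).
have d0 : 0 < d by rewrite lt_min ltr01 divr_gt0 // ltr_wpDl.
have d1 : d <= 1 by rewrite ge_min lexx.
exists d; split=> // y hy; rewrite -qE pevalE.
apply: (@le_trans _ _ (M * d)).
  rewrite (le_trans (nm_sum _ _ _)) // mulr_suml big_seq [leRHS]big_seq.
  apply: ler_sum => a aq; rewrite nmM ler_wpM2l ?nm_ge0 //.
  rewrite (le_trans (nm_monomial a hy)) // -[leRHS]expr1.
  apply: ler_wiXn2l => //; first exact: ltW.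
  rewrite lt0n mpoly.mdeg_eq0; apply: contraTneq aq => ->.
  by rewrite mpoly.mcoeff_msupp q0 eqxx.
have : d <= e / (M + 1) by rewrite ge_min lexx orbT.
rewrite ler_pdivlMr ?ltr_wpDl //; nra.
Qed.

(** Polynomials uniformly close to g on the large polydisc are bounded there and
    nearly zero around x, so they are small on an intermediate polydisc around x,
    which still contains a neighbourhood of 0. *)
Lemma identity_principle r g x (delta : R) : 0 < r -> poly_approx r g ->
  polydisc (r / 16) x -> 0 < delta ->
  (forall y, polydisc delta y -> g (x + y) = 0) ->
  forall w, polydisc (r / 16) w -> g w = 0.
Proof.
move=> r0 h hx d0' hz w hw; pose rho := r / 8.
have r16 : 0 < r / 16 by rewrite divr_gt0.
wlog drho : delta d0' hz / delta <= 2 * rho.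
  move=> W; have [|//] := leP delta (2 * rho); first exact: W.
  move=> hlt; apply: (W (2 * rho)) => //; first by rewrite /rho; lra.
  by move=> y hy; apply: hz; apply: polydisc_le hy; exact: ltW.
have [p1 hp1] := h 1 ltr01.
have [B [B0 hB]] := peval_bounded p1 (ltW r0).
apply: (@nm_eq _ C^o) => e e0; rewrite subr0.
have e3 : 0 < e / 3 by lra.
have [J /(_ J (leqnn J)) hJ] := half_pow ((B + 2) * 2 ^+ n) e3.
have n2 : 0 < 2 ^+ n :> R by rewrite exprn_gt0.
have q1 : 0 < 2 * rho / delta by rewrite divr_gt0 // /rho; lra.
have qJ : 0 < (2 * rho / delta) ^+ J by rewrite exprn_gt0.
pose e' := Num.min 1 (Num.min (e / 3) (e / 3 / ((2 * rho / delta) ^+ J * 2 ^+ n))).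
have e'0 : 0 < e' by rewrite !lt_min ltr01 e3 /= divr_gt0 // mulr_gt0.
have e'1 : e' <= 1 by rewrite ge_min lexx.
have e'2 : e' <= e / 3 by rewrite !ge_min lexx /= orbT.
have e'3 : e' * ((2 * rho / delta) ^+ J * 2 ^+ n) <= e / 3.
  by rewrite -ler_pdivlMr ?mulr_gt0 // !ge_min lexx !orbT.
have [p hp] := h e' e'0; have [p' hp'] := peval_translate x p.
have h1 : nm (g w - peval p w : C^o) <= e'.
  by apply: hp; apply: polydisc_le hw; lra.
have h2 : nm (peval p' (w - x) : C^o) <=
    (e' * (2 * rho / delta) ^+ J + (B + 2) * 2^-1 ^+ J) * 2 ^+ n.
  apply: two_constants => //.
  - exact: ltW.
  - by lra.
  - move=> z hzz; have sz : polydisc delta z by move=> i; rewrite hzz.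
    rewrite hp' -[peval _ _]subr0 nmC -(hz z sz) hp //.
    by apply: polydisc_le (polydiscD hx sz); rewrite /rho in drho; lra.
  - move=> z hzz; have sz : polydisc (4 * rho) z by move=> i; rewrite hzz.
    have sxz : polydisc r (x + z).
      by apply: polydisc_le (polydiscD hx sz); rewrite /rho; lra.
    rewrite hp'; have := hp _ sxz; have := hp1 _ sxz; have := hB _ sxz => b1 b2 b3.
    have t1 := @nm_le_dist R C^o (g (x + z)) (peval p (x + z)).
    have t2 := @nm_le_dist R C^o (peval p1 (x + z)) (g (x + z)).
    rewrite nmC in t1; move: b1 b2 b3 t1 t2 e'1; clear; lra.
  - by apply: polydisc_le (polydiscD hw (polydiscN hx)); rewrite /rho; lra.
rewrite hp' addrC subrK in h2.
have := @nm_le_dist R C^o (peval p w) (g w).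
move: h2; rewrite mulrDl => h2 h3.
have : (B + 2) * 2^-1 ^+ J * 2 ^+ n <= e / 3 by rewrite mulrAC mulrC ltW.
rewrite -mulrA in h2; move: h1 h2 h3 e'2 e'3; clear; lra.
Qed.

Lemma monomialZ (t : C) y a :
  monomial (t *: y) a = t ^+ mpoly.mdeg a * monomial y a.
Proof.
rewrite mpoly.mdegE expr_sum -big_split /=.
by apply: eq_bigr => i _; rewrite mxE exprMn.
Qed.

Lemma trunc_homogeneous k c (t : C) y :
  (forall a, (mpoly.mdeg a < k)%N -> c a = 0) ->
  peval (trunc k.+1 c) (t *: y) = t ^+ k * peval (trunc k.+1 c) y.
Proof.
move=> ck; rewrite /trunc !peval_sum mulr_sumr; apply: eq_bigr => m _.
rewrite !pevalZ !pevalX; have := mpoly.bmdeg m.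
rewrite ltnS leq_eqVlt => /orP[/eqP mk|/ck ->]; last by rewrite !mul0r mulr0.
by rewrite mulrCA monomialZ mk.
Qed.

(** Let P be the leading form of g, of degree k, and v a point of the unit torus
    with P(v) <> 0.  At scale rho, P(x + t v) = t^k P(v + x / t) has size rho^k
    when |x| is small compared with |t| = rho, while g - P is of order
    rho^(k+1). *)
Lemma circle_lower_bound c r g s : 0 < r -> expansion c r g ->
  (exists a, c a != 0) -> 0 < s ->
  exists v (rho eta kappa : R),
    [/\ polydisc 1 v, 0 < rho <= s, 0 < eta <= s, 0 < kappa &
     forall x (t : C), polydisc eta x -> nm (t : C^o) = rho ->
       kappa <= nm (g (x + t *: v) : C^o)].
Proof.
move=> r0 h [a0 ca0] s0.
have exk : exists k, `[< exists a, mpoly.mdeg a = k /\ c a != 0 >].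
  by exists (mpoly.mdeg a0); apply/asboolP; exists a0.
case: (ex_minnP exk) => k /asboolP[a [ak ca]] kmin.
have ck b : (mpoly.mdeg b < k)%N -> c b = 0.
  move=> bk; apply/eqP; apply: contraTT bk => cb; rewrite -leqNgt.
  by apply: kmin; apply/asboolP; exists b.
pose P := trunc k.+1 c.
(* otherwise Cauchy's estimate on the unit torus would kill all coefficients *)
have [v v1 Pv] : exists2 v : 'rV[C]_n, polydisc 1 v & peval P v != 0.
  apply: contrapT => nv.
  have : nm (mpoly.mcoeff a P : C^o) * 1 ^+ mpoly.mdeg a <= 0.
    apply: cauchy_estimate => // z hz.
    have -> : peval P z = 0; last by rewrite nm0.
    apply/eqP/negbNE/negP => Pz; apply: nv; exists z => // i; rewrite hz //.
  rewrite expr1n mulr1 mcoeff_trunc ak ltnSn => /(@nm_le0 _ C^o) ca0'.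
  by rewrite ca0' eqxx in ca.
pose k0 := nm (peval P v : C^o).
have k00 : 0 < k0 by exact: nm_neq0.
have [d [d0 d1 hd]] := peval_continuous P v (divr_gt0 k00 (ltr0n R 2)).
have [K [K0 hK]] := expansion_trunc r0 h.
pose M := K * (4 / r) ^+ k.+1.
have M0 : 0 <= M by rewrite mulr_ge0 // exprn_ge0 // divr_ge0 // ltW.
pose rho := Num.min s (Num.min (r / 4) (k0 / 4 / (M + 1))).
have rho0 : 0 < rho.
  by rewrite !lt_min s0 !divr_gt0 // ltr_wpDl.
have rho_s : rho <= s by rewrite ge_min lexx.
have rho_r : rho <= r / 4 by rewrite !ge_min lexx orbT.
have rho_M : M * rho <= k0 / 4.
  have : rho <= k0 / 4 / (M + 1) by rewrite !ge_min lexx !orbT.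
  rewrite ler_pdivlMr ?ltr_wpDl //; nra.
exists v, rho, (d * rho), (rho ^+ k * (k0 / 4)); split=> //.
- by rewrite rho0.
- by rewrite mulr_gt0 //= (le_trans _ rho_s) // ler_piMl // ltW.
- by rewrite mulr_gt0 ?divr_gt0 // exprn_gt0.
move=> x t hx ht.
have t0 : t != 0.
  by apply: contraTneq rho0 => t0; rewrite -ht t0 nm0 ltxx.
pose y := t^-1 *: x.
have hy : polydisc d y.
  have := polydiscZ (t^-1) hx; rewrite nmV ht; apply: polydisc_le.
  by rewrite mulrCA mulVf ?mulr1 // gt_eqF.
have E : x + t *: v = t *: (v + y).
  by rewrite scalerDr scalerA mulfV // scale1r addrC.
have PE : nm (peval P (x + t *: v) : C^o) = rho ^+ k * nm (peval P (v + y) : C^o).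
  by rewrite E trunc_homogeneous // nmM nmX ht.
have Py : k0 / 2 <= nm (peval P (v + y) : C^o).
  have := @nm_le_dist R C^o (peval P (v + y)) (peval P v).
  have := hd y hy; rewrite nmC -/k0; clear; lra.
have hw : polydisc (2 * rho) (x + t *: v).
  have := polydiscZ t v1; rewrite ht mulr1 => tv.
  apply: polydisc_le (polydiscD hx tv).
  have : d * rho <= rho by rewrite ler_piMl // ltW.
  clear; lra.
have := hK k.+1 (2 * rho) _ _ _ hw.
have -> : 2 * (2 * rho) / r = (4 / r) * rho by ring.
rewrite exprMn mulrA -/M exprS mulrA => hgP.
have {}hgP : nm (g (x + t *: v) - peval P (x + t *: v) : C^o) <= M * rho * rho ^+ k.
  by apply: hgP; move: rho0 rho_r; clear; lra.
have rk : 0 < rho ^+ k by rewrite exprn_gt0.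
have h1 : M * rho * rho ^+ k <= k0 / 4 * rho ^+ k by rewrite ler_pM2r.
have := @nm_le_dist R C^o (g (x + t *: v)) (peval P (x + t *: v)).
rewrite nmC PE => h2.
have h3 : rho ^+ k * (k0 / 2) <= rho ^+ k * nm (peval P (v + y) : C^o).
  by rewrite ler_pM2l.
move: h1 h2 h3 hgP; clear; lra.
Qed.

End Analytic.

(** * Uniform boundedness along a decreasing family of index sets *)

Section UniformBoundedness.
Variables (R : realType) (I : Type).
Notation C := (Cx R).
Variables (V : completeNormedModType C) (W : normedModType C).
Variables (A : nat -> set I) (ev : I -> V -> W).
Hypothesis A_decr : forall i j, (i <= j)%N -> A j `<=` A i.
Hypothesis ev_linear : forall i, A 0%N i -> linear (ev i).
Hypothesis ev_bounded : forall i, A 0%N i -> bounded_map (ev i).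
Hypothesis ev_eventually : forall g, exists N (K : R),
  forall i, A N i -> nm (ev i g) <= K.

(** One of x + h, x - h is mapped far away by ev i, if h is; the new radius is so
    small that all later perturbations of the chosen point, of total norm at most
    2 r', are harmless for this index i. *)
Lemma gliding_hump_step (k : nat) (x : V) (r : R) : 0 < r ->
  ~ (exists N (K : R), forall i, A N i -> forall g, nm (ev i g) <= K * nm g) ->
  exists xr : V * R, [/\ 0 < xr.2, xr.2 <= r / 2, nm (xr.1 - x) <= r &
    exists2 i, A k i & k.+1%:R <= nm (ev i xr.1) /\
      forall g, nm g <= 2 * xr.2 -> nm (ev i g) <= 1].
Proof.
move=> r0 unb; pose K := k.+1%:R / r.
have [i Ai [g hg]] : exists2 i, A k i & exists g, K * nm g < nm (ev i g).
  apply: contrapT => nex; apply: unb; exists k, K => i Ai g.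
  by rewrite leNgt; apply/negP => hg; apply: nex; exists i => //; exists g.
have A0i : A 0%N i by exact: (A_decr (leq0n k)).
have evD f h : ev i (f + h) = ev i f + ev i h.
  by have := ev_linear A0i 1 f h; rewrite !scale1r.
have ev0 : ev i 0 = 0.
  by apply: (addrI (ev i 0)); rewrite -evD !addr0.
have evZ c h : ev i (c *: h) = c *: ev i h.
  by have := ev_linear A0i c h 0; rewrite ev0 !addr0.
have evN h : ev i (- h) = - ev i h by rewrite -scaleN1r evZ scaleN1r.
have g0 : 0 < nm g.
  rewrite lt_neqAle nm_ge0 andbT eq_sym; apply: contraTneq hg => gz.
  by rewrite gz mulr0 (nm_le0 (x := g)) ?gz // ev0 nm0 ltxx.
have [M [M0 hM]] := proj1 (boundedP _) (ev_bounded A0i).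
pose r' := Num.min (r / 2) (1 / (2 * (M + 1))).
have r'0 : 0 < r'.
  by rewrite lt_min !divr_gt0 // mulr_gt0 // ltr_wpDl.
have r'r : r' <= r / 2 by rewrite ge_min lexx.
have r'M f : nm f <= 2 * r' -> nm (ev i f) <= 1.
  move=> hf; rewrite (le_trans (hM f)) //.
  have : r' <= 1 / (2 * (M + 1)) by rewrite ge_min lexx orbT.
  rewrite ler_pdivlMr; last by rewrite mulr_gt0 // ltr_wpDl.
  have := nm_ge0 f; nra.
pose h := toC (r / nm g) *: g.
have q0 : 0 <= r / nm g by rewrite divr_ge0 // ltW.
have hr : nm h = r by rewrite nmZ nm_toC ger0_norm // divfK // gt_eqF.
have evh : k.+1%:R <= nm (ev i h).
  rewrite evZ nmZ nm_toC ger0_norm //.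
  have -> : k.+1%:R = r / nm g * (K * nm g) :> R.
    by rewrite /K; field; rewrite !gt_eqF.
  by rewrite ler_wpM2l // ltW.
have [big|small] := leP k.+1%:R (nm (ev i (x + h))).
  exists (x + h, r'); split=> //=; last by exists i.
  by rewrite addrC addKr hr.
exists (x - h, r'); split=> //=.
  by rewrite addrC addKr nmN hr.
exists i => //; split=> //.
have E : ev i h *+ 2 = ev i (x + h) - ev i (x - h).
  by rewrite !evD evN opprD opprK addrACA subrr add0r mulr2n.
have : nm (ev i h *+ 2) = 2 * nm (ev i h) by rewrite -scaler_nat nmZ nm_nat.
rewrite E => E2; have := nmB (ev i (x + h)) (ev i (x - h)).
rewrite E2; lra.
Qed.

(** The principle of uniform boundedness where each vector is only required to be
    bounded along some A N, with N depending on the vector.  Iterating the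
    gliding hump otherwise produces a vector unbounded along all the A N. *)
Lemma eventual_uniform_boundedness :
  exists N (K : R), forall i, A N i -> forall g, nm (ev i g) <= K * nm g.
Proof.
apply: contrapT => unb.
have step (a : nat * (V * R)) : exists b : V * R, 0 < a.2.2 ->
    [/\ 0 < b.2, b.2 <= a.2.2 / 2, nm (b.1 - a.2.1) <= a.2.2 &
    exists2 i, A a.1 i & a.1.+1%:R <= nm (ev i b.1) /\
      forall g, nm g <= 2 * b.2 -> nm (ev i g) <= 1].
  have [r0|r0] := ltP 0 a.2.2; last by exists (0, 0).
  by have [b hb] := @gliding_hump_step a.1 a.2.1 a.2.2 r0 unb; exists b.
have [F hF] := choice step.
pose fix s k : V * R := if k is j.+1 then F (j, s j) else (0, 1).
have s_pos k : 0 < (s k).2.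
  by elim: k => [|k IH] /=; [exact: ltr01 | have [] := hF (k, s k) IH].
have r_half k : (s k).2 <= 2^-1 ^+ k.
  elim: k => [|k IH]; first by rewrite expr0.
  by have [_ h _ _] := hF (k, s k) (s_pos k); rewrite exprS /= in h *; lra.
have dist k j : nm ((s (k + j)%N).1 - (s k).1) <= 2 * (s k).2 - 2 * (s (k + j)%N).2.
  elim: j => [|j IH]; first by rewrite addn0 subrr nm0 subrr.
  have [_ h1 h2 _] := hF ((k + j)%N, s (k + j)%N) (s_pos _).
  rewrite addnS; have := nm_trans (s (k + j)%N).1 (s (k + j).+1).1 (s k).1.
  by rewrite /= in h1 h2 * => h3; lra.
have [l hl] : exists l, cvgR (fun k => (s k).1) l.
  apply: banach_complete => e e0; have [N hN] := half_pow 4 e0.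
  exists N => i j Ni Nj.
  rewrite -(subnKC Ni) -(subnKC Nj).
  have := nm_trans (s N).1 (s (N + (i - N))%N).1 (s (N + (j - N))%N).1.
  have := dist N (i - N)%N; have := dist N (j - N)%N.
  rewrite [nm ((s N).1 - _)]nmC.
  have := s_pos (N + (i - N))%N; have := s_pos (N + (j - N))%N.
  have := r_half N; have := hN N (leqnn N); lra.
have ldist k : nm (l - (s k).1) <= 2 * (s k).2.
  apply/ler_addgt0Pr => e e0; have [N hN] := hl e e0.
  have := nm_trans (s (k + N)%N).1 l (s k).1; have := dist k N.
  have := hN _ (leq_addl k N); rewrite [nm (_ - l)]nmC.
  have := s_pos (k + N)%N; lra.
have [N [K hK]] := ev_eventually l.
pose k := maxn N (Num.truncn K).+1.
have [_ _ _ [i Ai [big small]]] := hF (k, s k) (s_pos k).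
have A0i : A 0%N i by exact: (A_decr (leq0n k)).
have := hK i (A_decr (leq_maxl _ _) Ai).
have := small _ (ldist k.+1).
have -> : ev i (l - (s k.+1).1) = ev i l - ev i (s k.+1).1.
  by rewrite [l - _]addrC -scaleN1r (ev_linear A0i) scaleN1r addrC.
have := nm_le_dist (ev i l) (ev i (s k.+1).1); rewrite [nm (_ - ev i l)]nmC.
have : K < k%:R.
  by rewrite (lt_le_trans (truncnS_gt _)) // ler_nat leq_maxr.
move: big; rewrite /= -natr1; lra.
Qed.

End UniformBoundedness.

(** * Local bounds and division by a cyclic vector *)

Section AnalyticCriterion.
Variables (R : realType) (n : nat).
Notation C := (Cx R).

Lemma analytic_of_approx (E : set 'rV[C]_n) f :
  (forall u, E u -> exists2 r : R, 0 < r & poly_approx r (fun w => f (u + w))) ->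
  analytic_on E f.
Proof.
move=> h u Eu; have [r r0 hr] := h u Eu.
have [c hc] := approx_expansion r0 hr.
exists c; apply/near_rowP; exists (r / 2); split; first by rewrite divr_gt0.
move=> y hy; have := hc (y - u); rewrite [u + _]addrC subrK; apply=> i.
by have := hy i; rewrite !mxE => /ltW.
Qed.

Lemma approx_bounded r (g : 'rV[C]_n -> C) : 0 <= r -> poly_approx r g ->
  exists K, forall w, polydisc r w -> nm (g w : C^o) <= K.
Proof.
move=> r0 /(_ 1 ltr01)[p hp]; have [B [B0 hB]] := peval_bounded p r0.
exists (B + 1) => w hw; have := @nm_le_dist R C^o (peval p w) (g w).
by have := hp w hw; have := hB w hw; lra.
Qed.

Definition flat_at (f : 'rV[C]_n -> C) u := exists2 r : R, 0 < r &
  forall w, polydisc r w -> f (u + w) = 0.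

Lemma not_flat_coef f u c (r : R) : 0 < r -> expansion c r (fun w => f (u + w)) ->
  ~ flat_at f u -> exists a, c a != 0.
Proof.
move=> r0 h nflat; apply: contrapT => nc; apply: nflat; exists r => // w hw.
have c0 a : c a = 0 by apply/eqP/negbNE/negP => ca; apply: nc; exists a.
apply: (@nm_eq _ C^o) => e e0.
have /totally_cvgP /(_ e e0)[A /(_ A (fsubset_refl A))] := h w hw.
rewrite /power_sum big1 => [|a _]; last by rewrite c0 mul0r.
by rewrite nmC => /ltW.
Qed.

Lemma flat_near f u : flat_at f u -> exists2 r : R, 0 < r &
  forall w, polydisc r w -> flat_at f (u + w).
Proof.
move=> [r r0 hr]; have r2 : 0 < r / 2 by rewrite divr_gt0.
exists (r / 2) => // w hw; exists (r / 2) => // w' hw'.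
rewrite -addrA; apply: hr; apply: polydisc_le (polydiscD hw hw').
by rewrite -splitr.
Qed.

(** Together with [flat_near] this makes flatness both open and closed. *)
Lemma not_flat_near f u (r : R) : 0 < r -> poly_approx r (fun w => f (u + w)) ->
  ~ flat_at f u -> forall w, polydisc (r / 16) w -> ~ flat_at f (u + w).
Proof.
move=> r0 h nflat w hw [d d0 hd]; apply: nflat.
exists (r / 16); first by rewrite divr_gt0.
by apply: (identity_principle r0 h hw d0) => y hy; rewrite addrA hd.
Qed.

End AnalyticCriterion.

Section LocalBounds.
Variables (R : realType) (m : nat).
Notation C := (Cx R).
Variables (E : set 'rV[C]_m) (Y : banach_fun_space E).
Hypotheses (E_open : open E) (Y_analytic : forall g : Y, analytic_on E (fval g)).
Hypotheses (Y_P2 : P2 Y) (Y_P3 : P3 Y).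

Lemma fval_approx (g : Y) u : E u ->
  exists2 r : R, 0 < r & poly_approx r (fun w => fval g (u + w)).
Proof.
move=> Eu; have [c [r [r0 hr]]] := analytic_expansion (Y_analytic g) Eu.
by exists (r / 4); [rewrite divr_gt0 | exact: expansion_approx hr].
Qed.

(** Each element of Y is bounded near u, on a neighbourhood that depends on it;
    the principle of uniform boundedness makes neighbourhood and bound
    uniform. *)
Lemma evaluations_locally_bounded u : E u -> exists d K : R,
  [/\ 0 < d, 0 <= K & forall w, polydisc d w ->
     E (u + w) /\ forall g : Y, nm (fval g (u + w) : C^o) <= K * nm g].
Proof.
move=> Eu.
have [r [r0 hr]] : exists r : R, 0 < r /\ forall w, polydisc r w -> E (u + w).
  have /near_rowP[r [r0 hr]] : nbhs u E by apply: open_nbhs_nbhs.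
  exists (r / 2); split=> [|w hw]; first by rewrite divr_gt0.
  apply: hr => i; rewrite mxE addrAC subrr add0r (le_lt_trans (hw i)) //; lra.
pose A N : set 'rV[C]_m := polydisc (2^-1 ^+ N * r).
have A0 w : A 0%N w -> E (u + w) by rewrite /A expr0 mul1r; exact: hr.
have pos N : 0 < 2^-1 ^+ N * r by rewrite mulr_gt0 // exprn_gt0 // invr_gt0.
have [||||N [K hK]] := @eventual_uniform_boundedness R 'rV[C]_m Y C^o A
    (fun w g => fval g (u + w)).
- move=> i j ij w; apply: polydisc_le; rewrite ler_pM2r //.
  by apply: ler_wiXn2l => //; lra.
- by move=> w /A0 Ew c f g; rewrite fval_linear.
- by move=> w /A0 Ew; exact: Y_P2.
- move=> g; have [s s0 hs] := fval_approx g Eu.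
  have [K hK] := approx_bounded (ltW s0) hs.
  have [N /(_ N (leqnn N)) hN] := half_pow r s0.
  by exists N, K => w hw; apply: hK; apply: polydisc_le hw; exact: ltW.
exists (2^-1 ^+ N * r), `|K|; split=> // w hw; split.
  apply: A0; apply: polydisc_le hw; rewrite ler_pM2r //.
  by apply: ler_wiXn2l => //; lra.
move=> g; rewrite (le_trans (hK w hw g)) // ler_wpM2r ?nm_ge0 //.
exact: ler_norm.
Qed.

Variable a : Y.
Local Notation pm := (pmul Y_P3).

Definition dominated u (M : R) :=
  forall q, nm (peval q u : C^o) <= M * nm (pm q a).

(** The maximum principle on a circle where |a| >= kappa:
    |q(u)| <= max |q| <= max |q a| / kappa <= (K / kappa) |q a|. *)
Lemma dominated_near u : E u -> ~ flat_at (fval a) u -> exists d M : R,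
  [/\ 0 < d, 0 <= M & forall w, polydisc d w -> dominated (u + w) M].
Proof.
move=> Eu nflat; have [d [K [d0 K0 hK]]] := evaluations_locally_bounded Eu.
have [c [r [r0 hr]]] := analytic_expansion (Y_analytic a) Eu.
have d2 : 0 < d / 2 by rewrite divr_gt0.
have [v [rho [eta [kappa [v1 /andP[rho0 rhod] /andP[eta0 etad] kappa0 low]]]]] :=
  circle_lower_bound r0 hr (not_flat_coef r0 hr nflat) d2.
exists eta, (K / kappa); split=> // [|w hw q]; first by rewrite divr_ge0 // ltW.
apply: (@max_on_line _ _ _ _ v rho) => [|t ht]; first exact: ltW.
have hwt : polydisc d (w + t *: v).
  have := polydiscZ t v1; rewrite ht mulr1 => tv.
  by apply: polydisc_le (polydiscD hw tv); lra.
have [Ew hKw] := hK _ hwt; rewrite -addrA.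
rewrite mulrAC ler_pdivlMr //; apply: le_trans (hKw (pm q a)).
by rewrite pmulE // nmM ler_wpM2l ?nm_ge0 // low.
Qed.

(** The pair (g, c) lies in the closure of the graph of q a |-> q(u): c is the value
    at u of g / a, continued across the zeros of a. *)
Definition quotient_value u (g : Y) (c : C) := forall e : R, 0 < e ->
  exists p, nm (g - pm p a) < e /\ nm (c - peval p u : C^o) < e.

Lemma quotient_value_linear u g h c d (k : C) : quotient_value u g c ->
  quotient_value u h d -> quotient_value u (k *: g + h) (k * c + d).
Proof.
move=> hg hh e e0; have k1 : 0 < nm (k : C^o) + 1 by rewrite ltr_wpDl // nm_ge0.
have e2 : 0 < e / (nm (k : C^o) + 1) / 2 by rewrite !divr_gt0.
have e2' : 0 < e / 2 by rewrite divr_gt0.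
have bound (x : R) : 0 <= x -> x < e / (nm (k : C^o) + 1) / 2 ->
    nm (k : C^o) * x < e / 2.
  move=> x0; rewrite -mulrA mulrC -mulrA mulrC mulrC.
  rewrite [X in _ < X](_ : _ = (e / 2) / (nm (k : C^o) + 1)); last by ring.
  by rewrite ltr_pdivlMr // mulrDr mulr1 mulrC; lra.
have [p [p1 p2]] := hg _ e2; have [q [q1 q2]] := hh _ e2'.
exists (k *: p + q); split.
  rewrite pmulDl pmulZl opprD addrACA -scalerBr (le_lt_trans (nmD _ _)) //.
  by rewrite [e]splitr nmZ ltrD // bound // nm_ge0.
rewrite pevalD pevalZ opprD addrACA -mulrBr (le_lt_trans (nmD _ _)) //.
by rewrite [e]splitr nmM ltrD // bound // nm_ge0.
Qed.

Lemma quotient_valueM u g c p : quotient_value u g c ->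
  quotient_value u (pm p g) (peval p u * c).
Proof.
move=> hg e e0; have [M [M0 hM]] := pmul_bounded Y_P3 p.
pose B := M + nm (peval p u : C^o) + 1.
have B0 : 0 < B by rewrite /B ltr_wpDl // addr_ge0 // nm_ge0.
have [q [q1 q2]] := hg _ (divr_gt0 e0 B0).
have pu0 := @nm_ge0 R C^o (peval p u).
exists (p * q); split.
  rewrite -pmulA -pmulBr (le_lt_trans (hM _)) //.
  move: q1; rewrite ltr_pdivlMr // /B; have := nm_ge0 (g - pm q a); nra.
rewrite pevalM -mulrBr nmM.
move: q2; rewrite ltr_pdivlMr // /B.
have := @nm_ge0 R C^o (c - peval q u); nra.
Qed.

Lemma quotient_value_id u : quotient_value u a 1.
Proof.
by move=> e e0; exists 1; rewrite pmul1 peval1 !subrr !nm0.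
Qed.

Lemma quotient_value_fval u g c : E u -> quotient_value u g c ->
  fval g u = fval a u * c.
Proof.
move=> Eu hg; apply: (@nm_eq _ C^o) => e e0.
have [M [M0 hM]] := proj1 (boundedP _) (Y_P2 Eu).
pose B := M + nm (fval a u : C^o) + 1.
have B0 : 0 < B by rewrite /B ltr_wpDl // addr_ge0 // nm_ge0.
have [q [q1 q2]] := hg _ (divr_gt0 e0 B0).
rewrite (le_trans (nm_trans (fval (pm q a) u : C^o) _ _)) //.
rewrite {2}pmulE // [peval q u * _]mulrC -mulrBr nmM -fvalB //.
have := hM (g - pm q a); rewrite nmC in q2.
move: q1 q2; rewrite !ltr_pdivlMr // /B.
have := nm_ge0 (g - pm q a); have := @nm_ge0 R C^o (peval q u - c).
have := @nm_ge0 R C^o (fval a u); move: M0; clear.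
move: (nm _) (nm _) (nm _) (nm _) => fau qc gq fgq.
nra.
Qed.

Lemma quotient_value_bound u M g c q : 0 <= M -> dominated u M ->
  quotient_value u g c -> nm (c - peval q u : C^o) <= M * nm (g - pm q a).
Proof.
move=> M0 dom hg; apply/ler_addgt0Pr => e e0.
have M1 : 0 < M + 1 by rewrite ltr_wpDl.
pose d := e / (M + 1).
have dE : d + M * d = e by rewrite /d; field; rewrite gt_eqF.
have [p [/ltW p1 /ltW p2]] := hg d (divr_gt0 e0 M1).
rewrite (le_trans (nm_trans (peval p u : C^o) _ _)) // -pevalB -dE addrCA.
apply: lerD => //; rewrite (le_trans (dom _)) // pmulBl -mulrDr ler_wpM2l //.
by rewrite (le_trans (nm_trans g _ _)) // addrC lerD2l nmC.
Qed.

Lemma quotient_value_unique u M g c d : 0 <= M -> dominated u M ->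
  quotient_value u g c -> quotient_value u g d -> c = d.
Proof.
move=> M0 dom hc hd; apply: (@nm_eq _ C^o) => e e0.
have M1 : 0 < M + 1 by rewrite ltr_wpDl.
have [p [p1 p2]] := hd _ (divr_gt0 e0 M1).
rewrite (le_trans (nm_trans (peval p u : C^o) _ _)) //.
have := quotient_value_bound p M0 dom hc; rewrite [nm (peval p u - d)]nmC.
move: p1 p2; rewrite !ltr_pdivlMr //.
have := nm_ge0 (g - pm p a); have := @nm_ge0 R C^o (d - peval p u); nra.
Qed.

Hypothesis a_cyclic : cyclic_vector a.

Lemma quotient_value_exists u M g : 0 <= M -> dominated u M ->
  exists c, quotient_value u g c.
Proof.
move=> M0 dom.
have hj j : exists p, nm (g - pm p a) < 2^-1 ^+ j.
  by apply: (proj1 (cyclicP Y_P3 a) a_cyclic); rewrite exprn_gt0 // invr_gt0.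
have [p hp] := choice hj.
have [c hc] : exists c, cvgR (fun j => peval (p j) u : C^o) c.
  apply: C_complete => e e0; have [N hN] := half_pow (2 * M) e0.
  exists N => i j Ni Nj; rewrite -pevalB (le_lt_trans (dom _)) // pmulBl.
  have h2 k : (N <= k)%N -> nm (g - pm (p k) a) <= 2^-1 ^+ N.
    move=> Nk; rewrite (le_trans (ltW (hp k))) //.
    by apply: ler_wiXn2l => //; lra.
  apply: le_lt_trans (hN N (leqnn N)); rewrite mulrA [leRHS]mulrC.
  rewrite ler_wpM2l // (le_trans (nm_trans g _ _)) // nmC mulr_natr mulr2n.
  by rewrite lerD ?h2.
exists c => e e0; have [N hN] := hc e e0; have [N' hN'] := half_pow 1 e0.
exists (p (maxn N N')); split; last by rewrite nmC hN // leq_maxl.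
rewrite (lt_trans (hp _)) //; have := hN' _ (leq_maxr N N').
by rewrite mulr1.
Qed.

Lemma cyclic_common_zero u (g : Y) : E u -> fval a u = 0 -> fval g u = 0.
Proof.
move=> Eu au; apply: (@nm_eq _ C^o) => e e0.
have [M [M0 hM]] := proj1 (boundedP _) (Y_P2 Eu).
have M1 : 0 < M + 1 by rewrite ltr_wpDl.
have [p] := proj1 (cyclicP Y_P3 a) a_cyclic g _ (divr_gt0 e0 M1).
have := hM (g - pm p a); rewrite fvalB // pmulE // au mulr0 !subr0.
rewrite ltr_pdivlMr //; have := nm_ge0 (g - pm p a); nra.
Qed.

End LocalBounds.

(** * Operators that preserve cyclicity *)

Section CyclicityPreserving.
Variables (R : realType) (n m : nat).
Notation C := (Cx R).
Variables (Dhat : set 'rV[C]_n) (E : set 'rV[C]_m).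
Variables (X : banach_fun_space Dhat) (Y : banach_fun_space E).
Hypotheses (X_Q1 : Q1 X) (X_Q2 : Q2 X) (X_Q3 : Q3 X) (Y_P3 : P3 Y).
Variables (T : {linear X -> Y}) (one : X).
Hypothesis T_bounded : bounded_map T.
Hypothesis T_cyclic : forall f : X, cyclic_vector f -> cyclic_vector (T f).
Hypothesis oneP : represents one (fun=> 1).

(** The map f |-> (T f / a)(u) is a bounded functional that equals 1 at 1 and is
    nonzero at cyclic vectors, hence a point evaluation. *)
Lemma quotient_value_evaluation u (M : R) : 0 <= M ->
  dominated Y_P3 (T one) u M ->
  exists2 b, Dhat b &
    forall f : X, quotient_value Y_P3 (T one) u (T f) (fval f b).
Proof.
move=> M0 dom; have a_cyclic := T_cyclic (one_cyclic X_Q1 X_Q3 oneP).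
have [N hN] := choice (fun g =>
  @quotient_value_exists _ _ _ _ Y_P3 _ a_cyclic u M g M0 dom).
have uniq g c : quotient_value Y_P3 (T one) u g c -> N g = c.
  exact: (quotient_value_unique M0 dom (hN g)).
pose L (f : X) : C^o := N (T f).
have L_linear : linear L.
  move=> k f g; rewrite /L linearP; apply: uniq.
  exact: quotient_value_linear.
pose L' : {linear X -> C^o} :=
  HB.pack L (GRing.isLinear.Build _ _ _ _ _ L_linear).
have L_bounded : bounded_map L'.
  have [K [K0 hK]] := proj1 (boundedP _) T_bounded.
  apply/boundedP; exists (M * K); split=> [|f]; first exact: mulr_ge0.
  have := quotient_value_bound 0 M0 dom (hN (T f)).
  rewrite peval0 !subr0 => h; rewrite (le_trans h) // -mulrA ler_wpM2l //.
  rewrite (_ : pmul _ 0 _ = 0) ?subr0 //.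
  by apply: fval_inj => z Ez; rewrite pmulE // peval0 mul0r fval0.
have L_one : L' one = 1 by apply: uniq; exact: quotient_value_id.
have L_cyclic f : cyclic_vector f -> L' f != 0.
  move=> /T_cyclic cf; apply/eqP => Lf0.
  have M1 : 0 < M + 1 by rewrite ltr_wpDl.
  have M2 : 0 < (M + 1)^-1 by rewrite invr_gt0.
  have [p hp] := proj1 (cyclicP Y_P3 _) cf (T one) _ M2.
  have hv := quotient_valueM p (hN (T f)).
  rewrite (_ : N (T f) = 0) // mulr0 in hv.
  have := quotient_value_bound 1 M0 dom hv.
  rewrite peval1 pmul1 sub0r (@nmN _ C^o) nm1 nmC => h1.
  move: hp; rewrite -[_^-1]mul1r ltr_pdivlMr //.
  have := nm_ge0 (T one - pmul Y_P3 p (T f)); nra.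
have [b Db hb] := gleason_kahane_zelazko X_Q1 X_Q2 X_Q3 oneP L_bounded L_one L_cyclic.
by exists b => // f; rewrite -hb; exact: hN.
Qed.

End CyclicityPreserving.

Theorem theorem4p3 (R : realType) (n m : nat)
    (Dhat D : set 'rV[Cx R]_n) (E : set 'rV[Cx R]_m)
    (X : banach_fun_space Dhat) (Y : banach_fun_space E)
    (Dhat_neq0 : Dhat !=set0)
    (D_open : open D) (D_sub : D `<=` Dhat) (E_open : open E)
    (X_analytic : forall f : X, analytic_on D (fval f))
    (X_Q1 : Q1 X) (X_Q2 : Q2 X) (X_Q3 : Q3 X)
    (Y_analytic : forall g : Y, analytic_on E (fval g))
    (Y_P2 : P2 Y) (Y_P3 : P3 Y)
    (T : {linear X -> Y}) (T_bounded : bounded_map T)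
    (T_cyclic : forall f : X, cyclic_vector f -> cyclic_vector (T f)) :
  exists (one : X) (coord : 'I_n -> X) (a : Y)
         (b : 'rV[Cx R]_m -> 'rV[Cx R]_n),
    represents one (fun=> 1) /\
    (forall i, represents (coord i) (fun z => z 0 i)) /\
    analytic_on E (fval a) /\
    (forall i, analytic_on E (fun u => b u 0 i)) /\
    (forall u, E u -> Dhat (b u)) /\
    (forall (f : X) u, E u -> fval (T f) u = fval a u * fval f (b u)) /\
    a = T one /\
    cyclic_vector a /\
    (forall u, E u -> (exists g : Y, fval g u != 0) ->
       fval (T one) u != 0 /\
       forall i, b u 0 i = fval (T (coord i)) u / fval (T one) u).
Proof.
have [z0 Dz0] := Dhat_neq0.
have [one one_poly] := proj1 X_Q1 1.
have oneP : represents one (fun=> 1).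
  by move=> z Dz; rewrite one_poly // peval1.
have [coord coord_poly] :=
  choice (fun i : 'I_n => proj1 X_Q1 (mpoly.mpolyX (Cx R) (mpoly.mnm1 i))).
have coordP i : represents (coord i) (fun z => z 0 i).
  by move=> z Dz; rewrite coord_poly // pevalU.
pose a := T one.
have a_cyclic : cyclic_vector a by apply: T_cyclic; exact: one_cyclic.
have common_zero u (g : Y) : E u -> fval a u = 0 -> fval g u = 0.
  by move=> Eu au; apply: cyclic_common_zero au.
have flat0 u : flat_at (fval a) u -> fval a u = 0.
  by move=> [r r0 /(_ 0)]; rewrite addr0; apply; apply: polydisc0; exact: ltW.
have local u : exists b : 'rV[Cx R]_n, E u ->
    Dhat b /\
    (flat_at (fval a) u -> b = z0) /\
    (~ flat_at (fval a) u -> forall f : X,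
      quotient_value Y_P3 a u (T f) (fval f b)).
  have [[flat Eu]|nflat] := pselect (flat_at (fval a) u /\ E u).
    by exists z0.
  have [Eu|] := pselect (E u); last by exists z0.
  have {}nflat : ~ flat_at (fval a) u by move=> fl; apply: nflat.
  have [d [M [d0 M0 dom]]] :=
    dominated_near E_open Y_analytic Y_P2 Y_P3 Eu nflat.
  have := dom 0 (polydisc0 (ltW d0)); rewrite addr0 => domu.
  have [b Db hb] := quotient_value_evaluation X_Q1 X_Q2 X_Q3
    T_bounded T_cyclic oneP M0 domu.
  by exists b.
(* b u is an evaluation point off the flat set of a, and constant on it *)
have [b hb] := choice local.
have bE (f : X) u : E u -> fval (T f) u = fval a u * fval f (b u).
  move=> Eu; have [_ [_ qv]] := hb u Eu.
  have [flat|nflat] := pselect (flat_at (fval a) u).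
    by rewrite common_zero ?flat0 // mul0r.
  exact: quotient_value_fval (qv nflat f).
exists one, coord, a, b; do 3 split=> //; split; [|split; [|do 3 split=> //]].
- move=> i; apply: analytic_of_approx => u Eu.
  have [flat|nflat] := pselect (flat_at (fval a) u).
    have [r r0 hr] := flat_near flat.
    have [d [K [d0 _ hE]]] := evaluations_locally_bounded E_open Y_analytic Y_P2 Eu.
    exists (Num.min r d); first by rewrite lt_min r0.
    move=> e e0; exists (z0 0 i *: 1) => w hw.
    have Ew : E (u + w).
      by have [] := hE w (polydisc_le _ hw); rewrite ?ge_min ?lexx ?orbT.
    have flw : flat_at (fval a) (u + w).
      by apply: hr; apply: polydisc_le hw; rewrite ge_min lexx.
    have [_ [/(_ flw) bz _]] := hb (u + w) Ew.
    by rewrite bz pevalZ peval1 mulr1 subrr nm0 ltW.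
  have [r r0 ha] := fval_approx Y_analytic a Eu.
  have [d [M [d0 M0 dom]]] := dominated_near E_open Y_analytic Y_P2 Y_P3 Eu nflat.
  have [d' [K [d'0 _ hE]]] := evaluations_locally_bounded E_open Y_analytic Y_P2 Eu.
  have r16 : 0 < r / 16 by rewrite divr_gt0.
  exists (Num.min (r / 16) (Num.min d d')); first by rewrite !lt_min r16 d0.
  move=> e e0; have M1 : 0 < M + 1 by rewrite ltr_wpDl.
  have [p hp] := proj1 (cyclicP Y_P3 a) a_cyclic (T (coord i)) _ (divr_gt0 e0 M1).
  have [p' hp'] := peval_translate u p; exists p' => w hw.
  have Ew : E (u + w).
    by have [] := hE w (polydisc_le _ hw); rewrite ?ge_min ?lexx ?orbT.
  have domw : dominated Y_P3 a (u + w) M.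
    by apply: dom; apply: polydisc_le hw; rewrite !ge_min lexx ?orbT.
  have nfw : ~ flat_at (fval a) (u + w).
    by apply: (not_flat_near r0 ha nflat); apply: polydisc_le hw; rewrite ge_min lexx.
  have [Db [_ /(_ nfw (coord i))]] := hb (u + w) Ew.
  rewrite coordP // => qv; have := quotient_value_bound p M0 domw qv.
  rewrite hp'; move: hp; rewrite ltr_pdivlMr //.
  have := nm_ge0 (T (coord i) - pmul Y_P3 p a); nra.
- by move=> u /hb[].
- move=> u Eu [g gu]; have au : fval a u != 0.
    by apply: contraNneq gu => au; rewrite common_zero.
  split=> // i; have [Db _] := hb u Eu.
  by rewrite bE // coordP // mulrAC mulfV // mul1r.
Qed.
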